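(* Let $G$ be a finite simple graph that is $(C_4,C_5)$-free and vertex decomposable, let $R=K[V(G)]$ and let $I(G)\subset R$ be the edge ideal of $G$. Then $$\mathrm{v}(I(G))\le \mathrm{im}(G)=\mathrm{reg}(R/I(G)).$$
   Context: $K$ is a field; $R=K[V(G)]$ is the polynomial ring whose variables are the vertices of $G$, with the standard grading. The edge ideal $I(G)$ is generated by the monomials $xy$ with $\{x,y\}\in E(G)$. For a proper graded ideal $I$ of $R$, its v-number is $\mathrm{v}(I)=\min\{d\ge 0 : \exists f\in R_d \text{ and } \mathfrak{p}\in\mathrm{Ass}(R/I)\text{ with } (I:f)=\mathfrak{p}\}$, where $R_d$ is the degree-$d$ component of $R$. $\mathrm{reg}(R/I)$ is the Castelnuovo-Mumford regularity, $\max\{j-i:\beta_{i,j}(R/I)\ne0\}$. An induced matching in $G$ is a set $M$ of pairwise disjoint edges such that the induced subgraph of $G$ on $\bigcup_{e\in M}e$ has edge set exactly $M$; $\mathrm{im}(G)$ is the maximum cardinality of an induced matching. $G$ is $(C_4,C_5)$-free if it has no induced cycle of length $4$ or $5$. $G$ is vertex decomposable if its independence complex (the simplicial complex of independent sets of $G$) is vertex decomposable, where a simplicial complex $\Delta$ is vertex decomposable if it is a simplex, or empty, or has a vertex $v$ such that (a) both $\mathrm{del}_\Delta(v)=\{F\in\Delta: v\notin F\}$ and $\mathrm{lk}_\Delta(v)=\{F\in\Delta: v\notin F,\ F\cup\{v\}\in\Delta\}$ are vertex decomposable, and (b) every facet of $\mathrm{del}_\Delta(v)$ is a facet of $\Delta$.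 *)

(* Defs.v *)
From HB Require Import structures.
From mathcomp Require Import all_boot all_order all_algebra.
From mathcomp Require Import mpoly.

Set Implicit Arguments.
Unset Strict Implicit.
Unset Printing Implicit Defensive.

Import GRing.Theory.
Local Open Scope ring_scope.

(* Ideals of a polynomial ring S are represented as predicates S -> Prop. *)

Definition is_ideal (S : comNzRingType) (I : S -> Prop) : Prop :=
  [/\ I 0, forall a b, I a -> I b -> I (a + b) & forall a b, I b -> I (a * b)].

Definition ideal_gen (S : comNzRingType) (gens : S -> Prop) (f : S) : Prop :=
  exists k (a g : 'I_k -> S),
    (forall i, gens (g i)) /\ f = \sum_(i < k) a i * g i.

Definition is_prime_ideal (S : comNzRingType) (P : S -> Prop) : Prop :=
  [/\ is_ideal P, ~ P 1 & forall a b, P (a * b) -> P a \/ P b].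

Definition colon (S : comNzRingType) (I : S -> Prop) (f : S) : S -> Prop :=
  fun h => I (h * f).

(* P \in Ass(S/I): P is a prime of the form Ann(g + I) = (I : g). *)
Definition associated_prime (S : comNzRingType) (I P : S -> Prop) : Prop :=
  is_prime_ideal P /\ exists g, forall h, P h <-> colon I g h.

Definition v_degree (K : fieldType) (n : nat)
    (I : {mpoly K[n]} -> Prop) (d : nat) : Prop :=
  exists (f : {mpoly K[n]}) (P : {mpoly K[n]} -> Prop),
    [/\ f \is d.-homog, associated_prime I P & forall h, colon I f h <-> P h].

Definition is_vnumber (K : fieldType) (n : nat)
    (I : {mpoly K[n]} -> Prop) (v : nat) : Prop :=
  v_degree I v /\ forall d, v_degree I d -> (v <= d)%N.

(* A (possibly infinite) sequence of graded free S-modules of finite rank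
   F_i = \bigoplus_k S(- gdeg i k) with maps F_(i+1) -> F_i and F_0 -> S.
   Elements of F_i are row vectors, and the maps act by right multiplication. *)
Record free_sequence (K : fieldType) (n : nat) := FreeSequence {
  grank : nat -> nat;
  gdeg : forall i, 'I_(grank i) -> nat;
  gdiff : forall i, 'M[{mpoly K[n]}]_(grank i.+1, grank i);
  gaug : 'cV[{mpoly K[n]}]_(grank 0)
}.

(* The maps preserve degrees: an entry from S(-a) to S(-b) lies in S_(a-b),
   which is 0 when a < b. *)
Definition homogeneous_maps (K : fieldType) (n : nat)
    (F : free_sequence K n) : Prop :=
  (forall i k l,
     if (gdeg (i := i) l <= gdeg (i := i.+1) k)%N
     then gdiff F i k l \is (gdeg k - gdeg l)%N.-homog
     else gdiff F i k l == 0)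
  /\ (forall k, gaug F k 0 \is (gdeg k).-homog).

(* Exactness of  ... -> F_1 -> F_0 -> S/I -> 0. *)
Definition resolves_quotient (K : fieldType) (n : nat)
    (I : {mpoly K[n]} -> Prop) (F : free_sequence K n) : Prop :=
  [/\ forall h : {mpoly K[n]}, exists u : 'rV_(grank F 0),
        I (h - (u *m gaug F) 0 0),
      forall u : 'rV_(grank F 0),
        I ((u *m gaug F) 0 0) <-> exists w, u = w *m gdiff F 0
    & forall i (u : 'rV_(grank F i.+1)),
        u *m gdiff F i = 0 <-> exists w, u = w *m gdiff F i.+1].

(* The image of F_(i+1) lies in m F_i, with m the ideal of the variables. *)
Definition minimal_maps (K : fieldType) (n : nat)
    (F : free_sequence K n) : Prop :=
  forall i k l, (gdiff F i k l)@_0%MM = 0.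

Definition minimal_graded_free_resolution (K : fieldType) (n : nat)
    (I : {mpoly K[n]} -> Prop) (F : free_sequence K n) : Prop :=
  [/\ homogeneous_maps F, resolves_quotient I F & minimal_maps F].

(* b = \beta_{i,j}(S/I) *)
Definition is_betti (K : fieldType) (n : nat)
    (I : {mpoly K[n]} -> Prop) (i j b : nat) : Prop :=
  exists F, minimal_graded_free_resolution I F
    /\ b = #|[set k : 'I_(grank F i) | gdeg k == j]|.

(* r = reg(S/I) = max {j - i : \beta_{i,j}(S/I) <> 0}, for a proper graded
   ideal I; then \beta_{i,j}(S/I) <> 0 forces i <= j, so r is a natural. *)
Definition is_regularity (K : fieldType) (n : nat)
    (I : {mpoly K[n]} -> Prop) (r : nat) : Prop :=
  (exists i j b, [/\ is_betti I i j b, b <> 0%N & j = (i + r)%N])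
  /\ (forall i j b, is_betti I i j b -> b <> 0%N -> (j <= i + r)%N).

(* The vertex x is the variable of index enum_rank x. *)
Definition edge_ideal (K : fieldType) (V : finType) (e : rel V) :
    {mpoly K[#|V|]} -> Prop :=
  ideal_gen (fun m => exists x y : V,
    e x y /\ m = 'X_(enum_rank x) * 'X_(enum_rank y)).
Arguments edge_ideal K {V} e _.

Definition is_edge (V : finType) (e : rel V) (A : {set V}) : bool :=
  [exists x, exists y, e x y && (A == [set x; y])].

Definition induced_matching (V : finType) (e : rel V)
    (M : {set {set V}}) : bool :=
  [&& [forall A in M, is_edge e A], trivIset M
    & [forall A : {set V}, is_edge e A && (A \subset cover M) ==> (A \in M)]].

Definition induced_matching_number (V : finType) (e : rel V) : nat :=
  \max_(M : {set {set V}} | induced_matching e M) #|M|.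

(* For k >= 3; ordS is the cyclic successor on 'I_k. *)
Definition has_induced_cycle (V : finType) (e : rel V) (k : nat) : Prop :=
  exists f : 'I_k -> V, injective f /\
    forall i j, e (f i) (f j) = (j == ordS i) || (i == ordS j).

Definition C4_C5_free (V : finType) (e : rel V) : Prop :=
  ~ has_induced_cycle e 4 /\ ~ has_induced_cycle e 5.

Definition deletion (V : finType) (D : {set {set V}}) (v : V) : {set {set V}} :=
  [set F in D | v \notin F].

Definition link (V : finType) (D : {set {set V}}) (v : V) : {set {set V}} :=
  [set F in D | (v \notin F) && (v |: F \in D)].

Definition is_facet (V : finType) (D : {set {set V}}) (F : {set V}) : bool :=
  maxset (fun A => A \in D) F.

Inductive vertex_decomposable_complex (V : finType) :
    {set {set V}} -> Prop :=
| VD_empty : vertex_decomposable_complex set0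
| VD_simplex (F : {set V}) : vertex_decomposable_complex (powerset F)
| VD_vertex (D : {set {set V}}) (v : V) of
    [set v] \in D
  & vertex_decomposable_complex (deletion D v)
  & vertex_decomposable_complex (link D v)
  & (forall F, is_facet (deletion D v) F -> is_facet D F) :
    vertex_decomposable_complex D.

Definition independence_complex (V : finType) (e : rel V) : {set {set V}} :=
  [set A : {set V} | [forall x in A, forall y in A, ~~ e x y]].

Definition vertex_decomposable (V : finType) (e : rel V) : Prop :=
  vertex_decomposable_complex (independence_complex e).

(* Main.v *)
Require Import Defs.
From HB Require Import structures.
From mathcomp Require Import all_boot all_order all_algebra.
From mathcomp Require Import mpoly.
From mathcomp Require Import zify ring.
From Stdlib Require Import Classical ClassicalEpsilon.

(** Let S be the polynomial ring, I the edge ideal of G, and r the induced matching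
    number of G.

    Betti numbers are read off Koszul homology: a minimal graded free resolution F
    of S/I has a generator of degree j in F_i exactly when H_i(x; S/I), the Koszul
    homology on all variables, is nonzero in degree j ([vanish_no_generator] and
    [generator_nonvanish]). This is dimension shifting: if D : F -> N is a minimal
    cover with syzygy module N', then H_(p+1)(N) and H_p(N') vanish in the same
    degrees ([koszul_shift], [koszul_unshift]), and H_0(N) vanishes in degree j
    exactly when F has no generator of degree j. The shift also carries bounds on
    degrees from one syzygy module to the next, so that each of them is finitely
    generated and a minimal resolution exists ([min_resolutionP]).

    Upper bound on the regularity. A shedding vertex x of a graph without induced
    4-cycles and 5-cycles has a neighbour y with N[y] contained in N[x]
    ([shedding_dominated]). The edge xy extends every induced matching of G - N[x],
    so the induced matching number drops when N[x] is removed. The ideals (I : x)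
    and (I, x) are, up to variables, the edge ideals of G - N[x] and of G - x, and
    the exact sequence 0 -> S/(I : x)(-1) -> S/I -> S/(I, x) -> 0 gives by induction
    that H_i(x; S/I) lives in degrees at most i + r ([graph_bounded]).

    Lower bound. For a maximum induced matching with edges a_1 b_1, ..., a_r b_r the
    product of the x_(b_s) e_(a_s) is a Koszul cycle of homological degree r and
    total degree 2r. A linear form that sums coefficients over the transversals of
    the matching vanishes on boundaries and on I, but not on this cycle
    ([matching_nonvanish]).

    The v-number. The vertices x at which the induction removes N[x] form an
    independent set A of at most r vertices such that N(A) is a vertex cover
    ([shedding_cover]). If f is the product of the variables in A, then (I : f) is
    the prime ideal generated by the variables in N(A) ([v_degree_le_depth]). *)

Set Implicit Arguments.
Unset Strict Implicit.
Unset Printing Implicit Defensive.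

Import GRing.Theory.
Local Open Scope ring_scope.

(** * The Koszul complex of a sequence with coefficients in a module *)

Section Koszul.
Variable S : comNzRingType.
Implicit Types (xs : seq S) (M : lmodType S).

Definition submodule_pred M (P : M -> Prop) : Prop :=
  [/\ P 0, forall u v, P u -> P v -> P (u + v) & forall a u, P u -> P (a *: u)].

Definition additive_pred M (P : M -> Prop) : Prop :=
  [/\ P 0, forall u v, P u -> P v -> P (u + v) & forall u, P u -> P (- u)].

Lemma submodule_additive M (P : M -> Prop) : submodule_pred P -> additive_pred P.
Proof. by case=> P0 PD PZ; split=> // u Pu; rewrite -scaleN1r; apply: PZ. Qed.

Lemma submodule_pred0 M : submodule_pred (fun u : M => u = 0).
Proof. by split=> // [u v -> ->|a u ->]; rewrite ?addr0 ?scaler0. Qed.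

Lemma additive_predB M (P : M -> Prop) u v :
  additive_pred P -> P u -> P v -> P (u - v).
Proof. by case=> _ PD PN Pu Pv; apply: PD => //; apply: PN. Qed.

Lemma submodule_predB M (P : M -> Prop) u v :
  submodule_pred P -> P u -> P v -> P (u - v).
Proof. by move/submodule_additive/additive_predB; apply. Qed.

(** The Koszul complex is an iterated mapping cone: K(x :: xs; M) is the cone of
    multiplication by x on K(xs; M), the pair (u, v) standing for u + e_x v.
    This makes the signs of the differential implicit and turns each statement
    about it into an induction on the sequence; all homological degrees live in
    the same module, and [kdeg] singles out one of them. *)
Fixpoint kos xs M : lmodType S :=
  if xs is _ :: xs' then (kos xs' M * kos xs' M)%type else M.

Fixpoint kd xs M : kos xs M -> kos xs M :=
  if xs is x :: xs' return kos xs M -> kos xs M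
  then fun z => (kd z.1 + x *: z.2, - kd z.2) else fun=> 0.

Fixpoint kall M (P : M -> Prop) xs : kos xs M -> Prop :=
  if xs is x :: xs' return kos xs M -> Prop
  then fun z => kall P z.1 /\ kall P z.2 else P.

Fixpoint kdeg M xs (p : nat) : kos xs M -> Prop :=
  if xs is x :: xs' return kos xs M -> Prop
  then fun z => kdeg p z.1 /\ (if p is p'.+1 then kdeg p' z.2 else z.2 = 0)
  else fun z => if p is 0 then True else z = 0.

Fixpoint kmap M M' (f : M -> M') xs : kos xs M -> kos xs M' :=
  if xs is x :: xs' return kos xs M -> kos xs M'
  then fun z => (kmap f z.1, kmap f z.2) else f.

(** [kcoef0] and [kconst] identify M with the part of homological degree 0;
    [kcoef0] is the coefficient of the empty exterior product. *)
Fixpoint kcoef0 M xs : kos xs M -> M :=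
  if xs is x :: xs' return kos xs M -> M then fun z => kcoef0 z.1 else id.

Fixpoint kconst M xs (u : M) : kos xs M :=
  if xs is x :: xs' return kos xs M then (kconst xs' u, 0) else u.

Lemma pairD (A B : lmodType S) (a a' : A) (b b' : B) :
  (a, b) + (a', b') = (a + a', b + b'). Proof. by []. Qed.
Lemma pairZ (A B : lmodType S) s (a : A) (b : B) : s *: (a, b) = (s *: a, s *: b).
Proof. by []. Qed.

Lemma kd_is_linear xs M : linear (@kd xs M).
Proof.
elim: xs => [|x xs IH] a /= z w; first by rewrite scaler0 addr0.
rewrite !IH pairZ pairD; congr (_, _).
  rewrite !scalerDr !scalerA (mulrC a) -!addrA; congr (_ + _).
  by rewrite addrCA.
by rewrite scalerN opprD.
Qed.
HB.instance Definition _ xs M := 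
  GRing.isLinear.Build S (kos xs M) (kos xs M) _ (@kd xs M) (@kd_is_linear xs M).

Section KdLinear.
Variables (M : lmodType S) (xs : seq S).
Implicit Types z w : kos xs M.
Lemma kdD z w : kd (z + w) = kd z + kd w. Proof. exact: linearD. Qed.
Lemma kdB z w : kd (z - w) = kd z - kd w. Proof. exact: linearB. Qed.
Lemma kdN z : kd (- z) = - kd z. Proof. exact: linearN. Qed.
Lemma kdZ a z : kd (a *: z) = a *: kd z. Proof. exact: linearZ. Qed.
Lemma kd0 : kd (0 : kos xs M) = 0. Proof. exact: linear0. Qed.
End KdLinear.

Lemma kd_kd xs M (z : kos xs M) : kd (kd z) = 0.
Proof.
elim: xs z => [|x xs IH] //= [u v] /=.
rewrite linearD linearZ /= !linearN /= !IH !oppr0 add0r.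
by rewrite addrN.
Qed.

Section Map.
Variables (M M' : lmodType S) (f : {linear M -> M'}).

Lemma kmap_is_linear xs : linear (@kmap M M' f xs).
Proof.
elim: xs => [|x xs IH] a /= z w; first by rewrite linearP.
by rewrite !IH.
Qed.
HB.instance Definition _ xs := 
  GRing.isLinear.Build S (kos xs M) (kos xs M') _ (@kmap M M' f xs) (@kmap_is_linear xs).

Lemma kd_map xs (z : kos xs M) : kd (kmap f z) = kmap f (kd z).
Proof.
elim: xs z => [|x xs IH] //= z; first by rewrite linear0.
by rewrite !IH linearD linearN linearZ.
Qed.

Lemma kmap_const xs u : kmap f (kconst xs u) = kconst xs (f u).
Proof. by elim: xs => [|x xs IH] //=; rewrite IH linear0. Qed.

End Map.

Lemma kmap_scale M x xs (z : kos xs M) : kmap (fun u => x *: u) z = x *: z.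
Proof. by elim: xs z => [|y xs IH] //= [u v]; rewrite !IH. Qed.

Lemma kmap0 M M' (f : M -> M') xs : f 0 = 0 -> kmap f (0 : kos xs M) = 0.
Proof. by move=> f0; elim: xs => [|y xs IH] //=; rewrite !IH. Qed.

Section All.
Variables (M : lmodType S).

Lemma kall_map M' (f : M -> M') (P : M -> Prop) (Q : M' -> Prop) xs z :
  (forall u, P u -> Q (f u)) -> kall P z -> @kall _ Q xs (kmap f z).
Proof. by move=> PQ; elim: xs z => [|x xs IH] /= z; [exact: PQ|by case=> /IH ? /IH]. Qed.

Lemma kall_map_inv M' (f : M -> M') (P : M -> Prop) (Q : M' -> Prop) xs z :
  (forall u, Q (f u) -> P u) -> @kall _ Q xs (kmap f z) -> kall P z.
Proof. by move=> PQ; elim: xs z => [|x xs IH] /= z; [exact: PQ|by case=> /IH ? /IH]. Qed.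

Lemma kall_impl (P Q : M -> Prop) xs z :
  (forall u, P u -> Q u) -> kall P z -> @kall _ Q xs z.
Proof. by move=> PQ; elim: xs z => [|x xs IH] /= z; [exact: PQ|by case=> /IH ? /IH]. Qed.

Lemma kallT (P : M -> Prop) xs z : (forall u, P u) -> @kall _ P xs z.
Proof. by move=> PT; elim: xs z => [|x xs IH] //=. Qed.

Lemma kall_eq0 xs z : @kall M (fun u => u = 0) xs z -> z = 0.
Proof. by elim: xs z => [|x xs IH] //= [u v] [/= /IH-> /IH->]. Qed.

Lemma kall0 (P : M -> Prop) xs : P 0 -> @kall _ P xs 0.
Proof. by move=> P0; elim: xs => [|x xs IH]. Qed.

Lemma kall_additive (P : M -> Prop) xs :
  additive_pred P -> additive_pred (@kall _ P xs).
Proof.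
case=> P0 PD PN; split; first exact: kall0.
  by elim: xs => [|x xs IH] /= z w; [exact: PD|case=> ? ? [? ?]; split; apply: IH].
by elim: xs => [|x xs IH] /= z; [exact: PN|case=> ? ?; split; apply: IH].
Qed.

Lemma kallZ (P Q : M -> Prop) a xs z :
  (forall u, P u -> Q (a *: u)) -> @kall _ P xs z -> kall Q (a *: z).
Proof. by move=> PQ; elim: xs z => [|x xs IH] /= z; [exact: PQ|case=> ? ?; split; apply: IH]. Qed.

(** Passing from P to Q allows the differential to change the internal degree of
    the coefficients, as it multiplies them by the entries of xs. *)
Lemma kall_d (P Q : M -> Prop) xs z : additive_pred Q ->
  (forall x u, x \in xs -> P u -> Q (x *: u)) -> @kall _ P xs z -> kall Q (kd z).
Proof.
move=> aQ; have [Q0 _ _] := aQ; elim: xs z => [|x xs IH] //= [u v] PQ [/= Pu Pv].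
have [_ kD kN] := kall_additive xs aQ.
have PQ' y w : y \in xs -> P w -> Q (y *: w).
  by move=> yxs; apply: PQ; rewrite inE yxs orbT.
split; last by apply: kN; apply: IH.
apply: kD; first exact: IH.
by apply: kallZ Pv => w; apply: PQ; rewrite mem_head.
Qed.

Lemma kall_d_sub (P : M -> Prop) xs z :
  submodule_pred P -> @kall _ P xs z -> kall P (kd z).
Proof.
move=> sP; apply: kall_d; first exact: submodule_additive.
by case: sP => _ _ PZ x u _; apply: PZ.
Qed.

Lemma kall_const (P : M -> Prop) xs u : P 0 -> P u -> kall P (kconst xs u).
Proof. by move=> P0 Pu; elim: xs => [|x xs IH] //=; split=> //; apply: kall0. Qed.

Lemma kall_coef0 (P : M -> Prop) xs z : @kall _ P xs z -> P (kcoef0 z).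
Proof. by elim: xs z => [|x xs IH] //= z [/IH]. Qed.

Lemma kconst_is_linear xs : linear (@kconst M xs).
Proof.
by elim: xs => [|x xs IH] //= a u v; rewrite IH pairZ scaler0 pairD addr0.
Qed.
HB.instance Definition _ xs :=
  GRing.isLinear.Build S M (kos xs M) _ (@kconst M xs) (@kconst_is_linear xs).

Lemma kcoef0_is_linear xs : linear (@kcoef0 M xs).
Proof. by elim: xs => [|x xs IH] //= a u v; rewrite IH. Qed.
HB.instance Definition _ xs :=
  GRing.isLinear.Build S (kos xs M) M _ (@kcoef0 M xs) (@kcoef0_is_linear xs).

Lemma kconstK xs u : kcoef0 (@kconst M xs u) = u.
Proof. by elim: xs => [|x xs IH]. Qed.

Lemma kcoef0K xs z : @kdeg M xs 0 z -> kconst xs (kcoef0 z) = z.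
Proof. by elim: xs z => [|x xs IH] //= [u v] [/= /IH-> ->]. Qed.

Lemma kdeg_const xs u : @kdeg M xs 0 (kconst xs u).
Proof. by elim: xs => [|x xs IH]. Qed.

Lemma kdeg0 xs p : @kdeg M xs p 0.
Proof. by elim: xs p => [|x xs IH] [|p] //=; split. Qed.

Lemma kdegP xs p a z w : @kdeg M xs p z -> kdeg p w -> kdeg p (a *: z + w).
Proof.
elim: xs p z w => [|x xs IH] [|p] //= z w.
- by move=> -> ->; rewrite scaler0 addr0.
- by case: z w => [u v] [u' v'] /= [? ->] [? ->]; rewrite scaler0 addr0; split=> //; apply: IH.
- by case: z w => [u v] [u' v'] /= [? ?] [? ?]; split; apply: IH.
Qed.

Lemma kdeg_submodule xs p : submodule_pred (@kdeg M xs p).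
Proof.
split; first exact: kdeg0.
  by move=> u v ? ?; rewrite -[u]scale1r; apply: kdegP.
by move=> a u ?; rewrite -[_ *: _]addr0; apply: kdegP => //; apply: kdeg0.
Qed.

Lemma kd_const xs u : kd (@kconst M xs u) = 0.
Proof. by elim: xs => [|y xs IH] //=; rewrite IH scaler0 linear0 oppr0 addr0. Qed.

Lemma kd_kdeg0 xs z : @kdeg M xs 0 z -> kd z = 0.
Proof. by move/kcoef0K <-; exact: kd_const. Qed.

Lemma kdeg_d xs p z : @kdeg M xs p.+1 z -> kdeg p (kd z).
Proof.
elim: xs p z => [|x xs IH] p /=; first by move=> z _; case: p.
case=> u v [/= /IH du dv]; have [_ kD kZ] := kdeg_submodule xs p.
split; first by apply: kD => //; apply: kZ.
case: p dv {du kD kZ} => [dv|p /IH dv]; last first.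
  by rewrite -scaleN1r; have [_ _] := kdeg_submodule xs p; apply.
by rewrite kd_kdeg0 ?oppr0.
Qed.

End All.

Lemma kdeg_map M M' (f : M -> M') xs p (z : kos xs M) :
  f 0 = 0 -> kdeg p z -> kdeg p (kmap f z).
Proof.
move=> f0; elim: xs p z => [|x xs IH] [|p] //=; first by move=> z ->.
  by case=> u v /= [? ->]; split; [apply: IH|rewrite kmap0].
by case=> u v /= [? ?]; split; apply: IH.
Qed.

(** A Koszul chain is a family of coefficients, so that any solution of u = f v
    modulo Z, coefficient by coefficient, lifts whole chains; the coefficients
    outside the given homological degree are lifted to 0. *)
Lemma kos_lift M M' (f : M' -> M) (P Z : M -> Prop) (Q : M' -> Prop) xs p z :
    Z 0 -> Q 0 -> f 0 = 0 ->
    (forall u, P u -> exists2 v, Q v & Z (u - f v)) ->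
    @kdeg M xs p z -> kall P z ->
  exists y, [/\ kdeg p y, kall Q y & kall Z (z - kmap f y)].
Proof.
move=> Z0 Q0 f0 lift.
have zeroP q (ys : seq S) : exists y : kos ys M',
    [/\ kdeg q y, y = 0, kall Q y & kall Z (0 - kmap f y)].
  exists 0; split=> //; [exact: kdeg0|exact: kall0|].
  by rewrite kmap0 // subr0; apply: kall0.
elim: xs p z => [|x xs IH] p /=.
  case: p => [|p] z; first by move=> _ /lift [v Qv Zv]; exists v.
  by move=> -> _; have [y [? ? ? ?]] := zeroP p.+1 [::]; exists y.
case=> u v /= [du dv] [Pu Pv].
have [y1 [dy1 Qy1 Zy1]] := IH _ _ du Pu.
case: p du dv dy1 => [|p] du dv dy1.
  rewrite dv; have [y [? ? ? ?]] := zeroP 0%N xs.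
  by exists (y1, y).
have [y2 [dy2 Qy2 Zy2]] := IH _ _ dv Pv.
by exists (y1, y2).
Qed.

End Koszul.

(** * Supports of polynomials and of rows of polynomials *)

Section Monomials.
Variables (K : fieldType) (n : nat).
Local Notation S := {mpoly K[n]}.
Local Notation mon := 'X_{1..n}.

Lemma msuppM_ex (f g : S) mo : mo \in msupp (f * g) ->
  exists m1 m2, [/\ m1 \in msupp f, m2 \in msupp g & mo = (m1 + m2)%MM].
Proof. by move/msuppM_le/allpairsP=> [[m1 m2] /= [? ? ?]]; exists m1, m2. Qed.

Lemma msuppMX_t t (f : S) mo : (mo + U_(t))%MM \in msupp ('X_t * f) = (mo \in msupp f).
Proof. by rewrite !mcoeff_msupp (mulrC _ f) addmC mcoeffMX. Qed.

Lemma msuppMX_ex t (f : S) mo : mo \in msupp ('X_t * f) ->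
  exists2 m1, m1 \in msupp f & mo = (m1 + U_(t))%MM.
Proof.
move/msuppM_ex=> [m1 [m2 [/mem_msuppXP <- m2f ->]]].
by exists m2; rewrite // addmC.
Qed.

Lemma mnm_neq0 (mo : mon) : mo != 0%MM -> exists t, (0 < mo t)%N.
Proof.
move=> mo0; case: (pickP (fun t => 0 < mo t)%N) => [t t0|none]; first by exists t.
by case/eqP: mo0; apply/mnmP=> t; have := none t; rewrite mnm0E; case: (mo t).
Qed.

(** The part of a polynomial carried by the monomials in P: a homogeneous
    component, or the part outside a monomial ideal. *)
Definition mfilter (P : pred mon) (f : S) : S :=
  \sum_(mo <- msupp f | P mo) f@_mo *: 'X_[mo].

Lemma mcoeff_filter P f mo : (mfilter P f)@_mo = if P mo then f@_mo else 0.
Proof.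
rewrite raddf_sum /=; under eq_bigr do rewrite mcoeffZ mcoeffX.
have [mof|mof] := boolP (mo \in msupp f); last first.
  rewrite (memN_msupp_eq0 mof) if_same big_seq_cond big1 // => m1 /andP [m1f _].
  by case: eqP => [e|]; rewrite ?mulr0 // e in m1f *; rewrite m1f in mof.
rewrite big_mkcond (bigD1_seq mo) //= eqxx mulr1 big1 ?addr0 // => m1 /negPf->.
by rewrite mulr0 if_same.
Qed.

Lemma mfilter_split P f : f = mfilter P f + mfilter (predC P) f.
Proof.
apply/mpolyP => mo; rewrite mcoeffD !mcoeff_filter /=.
by case: (P mo); rewrite ?addr0 ?add0r.
Qed.

Variable m : nat.
Implicit Types (u v : 'rV[S]_m) (P Q : 'I_m -> pred mon).

(** Homogeneity, membership in a monomial ideal and divisibility by a variable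
    are all conditions on the monomials that occur in each coordinate. *)
Definition rsupp P u : Prop := forall k mo, mo \in msupp (u 0 k) -> P k mo.

Definition rfilter P u : 'rV[S]_m := \row_k mfilter (P k) (u 0 k).

Lemma rsupp_additive P : additive_pred (rsupp P).
Proof.
split=> [k mo|u v Pu Pv k mo|u Pu k mo]; rewrite mxE.
- by rewrite msupp0.
- by move/msuppD_le; rewrite mem_cat => /orP [/Pu|/Pv].
- by rewrite (perm_mem (msuppN _)) => /Pu.
Qed.

Lemma rsupp0 P : rsupp P 0. Proof. by case: (rsupp_additive P). Qed.

Lemma rsupp_none P u : (forall k mo, ~~ P k mo) -> rsupp P u -> u = 0.
Proof.
move=> noP Pu; apply/rowP=> k; rewrite mxE; apply: msuppnil0.
case E: (msupp _) => [|mo s] //.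
by have := noP k mo; rewrite Pu // E mem_head.
Qed.

Lemma rsupp_impl P Q u : (forall k mo, P k mo -> Q k mo) -> rsupp P u -> rsupp Q u.
Proof. by move=> PQ Pu k mo /Pu /PQ. Qed.

Lemma rsupp_filter P u : rsupp P (rfilter P u).
Proof.
move=> k mo; rewrite mcoeff_msupp mxE mcoeff_filter.
by case: (P k mo); rewrite ?eqxx.
Qed.

Lemma rsupp_filter2 P Q u : rsupp Q u -> rsupp Q (rfilter P u).
Proof.
move=> Qu k mo; rewrite mcoeff_msupp mxE mcoeff_filter.
by case: (P k mo); rewrite ?eqxx // -mcoeff_msupp => /Qu.
Qed.

Lemma rfilter_split P u : u = rfilter P u + rfilter (fun k => predC (P k)) u.
Proof. by apply/rowP=> k; rewrite !mxE -mfilter_split. Qed.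

Lemma rfilter_id P u : rsupp P u -> rfilter P u = u.
Proof.
move=> Pu; apply/rowP=> k; apply/mpolyP => mo; rewrite mxE mcoeff_filter.
by case: ifP => // /negP Pmo; rewrite memN_msupp_eq0 //; apply/negP=> /Pu.
Qed.

Lemma rfilter_none P u : (forall k mo, mo \in msupp (u 0 k) -> ~~ P k mo) ->
  rfilter P u = 0.
Proof.
move=> Pu; apply/rowP=> k; apply/mpolyP => mo; rewrite !mxE mcoeff_filter mcoeff0.
by case: ifP => // Pmo; rewrite memN_msupp_eq0 //; apply/negP=> /Pu; rewrite Pmo.
Qed.

Lemma rfilterD P u v : rfilter P (u + v) = rfilter P u + rfilter P v.
Proof.
apply/rowP=> k; apply/mpolyP => mo; rewrite !mxE mcoeffD !mcoeff_filter mcoeffD.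
by case: (P k mo); rewrite ?addr0.
Qed.

Lemma rfilterB P u v : rfilter P (u - v) = rfilter P u - rfilter P v.
Proof. by rewrite -{2}[u](subrK v) (rfilterD _ (u - v)) addrK. Qed.

Lemma rfilter_sum P (I : Type) (r : seq I) (C : pred I) (F : I -> 'rV[S]_m) :
  rfilter P (\sum_(i <- r | C i) F i) = \sum_(i <- r | C i) rfilter P (F i).
Proof.
apply: (big_morph (rfilter P) (rfilterD P)).
by apply/rfilter_none=> k mo; rewrite mxE msupp0.
Qed.

Lemma rsupp_mulX P Q t u :
  (forall k mo, P k mo -> Q k (mo + U_(t))%MM) -> rsupp P u -> rsupp Q ('X_t *: u).
Proof. by move=> PQ Pu k mo; rewrite mxE => /msuppMX_ex [m1 /Pu /PQ ? ->]. Qed.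

Lemma rsupp_mulX_inv P Q t u :
  (forall k mo, Q k (mo + U_(t))%MM -> P k mo) -> rsupp Q ('X_t *: u) -> rsupp P u.
Proof. by move=> QP Qu k mo mou; apply/QP/Qu; rewrite mxE msuppMX_t. Qed.

Lemma rfilter_mulX P Q t u : (forall k mo, Q k (mo + U_(t))%MM = P k mo) ->
  rfilter Q ('X_t *: u) = 'X_t *: rfilter P u.
Proof.
move=> QP; rewrite {1}(rfilter_split P u) scalerDr rfilterD.
rewrite [X in X + _]rfilter_id ?[X in _ + X]rfilter_none ?addr0 //.
  move=> k mo; rewrite mxE => /msuppMX_ex [m1 m1u ->]; rewrite QP.
  exact: (rsupp_filter m1u).
by apply: (rsupp_mulX (P := P)) => [k mo|]; [rewrite QP|exact: rsupp_filter].
Qed.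

Lemma rdivX t u : rsupp (fun _ mo => (0 < mo t)%N) u -> exists v, u = 'X_t *: v.
Proof.
move=> tu.
exists (\row_k \sum_(mo <- msupp (u 0 k)) (u 0 k)@_mo *: 'X_[mo - U_(t)]).
apply/rowP=> k; rewrite !mxE mulr_sumr [LHS]mpolyE big_seq [RHS]big_seq.
apply: eq_bigr => mo /tu mot; rewrite -scalerAr -mpolyXD addmC submK //.
by apply/mnm_lepP => s; rewrite mnm1E; case: eqP => // <-.
Qed.

End Monomials.

(** * Koszul homology of graded subquotients and dimension shifting *)

Section Graded.
Variables (K : fieldType) (n : nat).
Local Notation S := {mpoly K[n]}.
Local Notation mon := 'X_{1..n}.
Local Notation kX ts := [seq ('X_t : S) | t <- ts].

(** Naming the instance makes the coefficient module of every Koszul complex of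
    rows the same term, on which rewriting relies. *)
Local Notation rowmod m := (matrix_matrix__canonical__GRing_Lmodule _ 1 m).

(** Basis vector k has degree degs k, and a is an offset that counts the exterior
    degree of a Koszul chain, so that j is a total degree and the Koszul
    differential preserves it. Writing the offset on the left avoids negative
    degrees. *)
Definition has_degree m (degs : 'I_m -> nat) (a j : nat) (k : 'I_m) (mo : mon) : bool :=
  (mdeg mo + degs k + a == j)%N.

Definition homog_row m (degs : 'I_m -> nat) (a j : nat) : 'rV[S]_m -> Prop :=
  rsupp (has_degree degs a j).

(** The rows with coordinates in the ideal generated by the variables in ts,
    recognised monomial by monomial. *)
Definition hits m (ts : seq 'I_n) : 'rV[S]_m -> Prop :=
  rsupp (fun _ mo => has (fun t => (0 < mo t)%N) ts).

Lemma has_degree_mulX m (degs : 'I_m -> nat) a j k mo t :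
  has_degree degs a j k (mo + U_(t))%MM = has_degree degs a.+1 j k mo.
Proof. by rewrite /has_degree mdegD mdeg1; congr (_ == _); lia. Qed.

Lemma hom_additive m (degs : 'I_m -> nat) a j : additive_pred (homog_row degs a j).
Proof. exact: rsupp_additive. Qed.

Lemma homX m (degs : 'I_m -> nat) a j t u :
  homog_row degs a.+1 j u -> homog_row degs a j ('X_t *: u).
Proof. by apply: rsupp_mulX => k mo; rewrite has_degree_mulX. Qed.

Lemma homX_inv m (degs : 'I_m -> nat) a j t u :
  homog_row degs a j ('X_t *: u) -> homog_row degs a.+1 j u.
Proof. by apply: rsupp_mulX_inv => k mo; rewrite has_degree_mulX. Qed.

Lemma kall_hom_d m (degs : 'I_m -> nat) a j ts (z : kos (kX ts) (rowmod m)) :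
  kall (homog_row degs a.+1 j) z -> kall (homog_row degs a j) (kd z).
Proof.
apply: kall_d; first exact: hom_additive.
by move=> x u /mapP [t _ ->]; exact: homX.
Qed.

Lemma kcoef0_d_hits m ts (w : kos (kX ts) (rowmod m)) : hits ts (kcoef0 (kd w)).
Proof.
elim: ts w => [|t ts IH] /=; first by move=> w; exact: rsupp0.
case=> u v /=; rewrite linearD linearZ /=.
have [_ addD _] := rsupp_additive K
  (fun (_ : 'I_m) (mo : mon) => has (fun t => (0 < mo t)%N) (t :: ts)).
apply: addD; first by apply: rsupp_impl (IH u) => k mo /= ->; rewrite orbT.
by move=> k mo; rewrite mxE => /msuppMX_ex [m1 _ ->] /=; rewrite mnmDE mnm1E eqxx addn1.
Qed.

(** H_0 of the Koszul complex of a free module is its quotient by the variables: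
    split off the monomials divisible by the first variable and recurse. *)
Lemma hits_kcoef0_d m (degs : 'I_m -> nat) a j ts (z : kos (kX ts) (rowmod m)) :
    kdeg 0 z -> hits ts (kcoef0 z) -> homog_row degs a j (kcoef0 z) ->
  exists w, [/\ kdeg 1 w, kall (homog_row degs a.+1 j) w & z = kd w].
Proof.
elim: ts z => [|t ts IH] /=.
  move=> z _ z0 _; exists 0; split=> //; first exact: rsupp0.
  exact: (rsupp_none _ z0).
case=> u v /= [du ->] hu hu'.
pose P (_ : 'I_m) (mo : mon) := (0 < mo t)%N.
have eu := rfilter_split P (kcoef0 u).
have [g eg] : exists g, rfilter P (kcoef0 u) = 'X_t *: g.
  by apply/rdivX/rsupp_filter.
rewrite eg in eu; set f := rfilter _ _ in eu.
have hf : hits ts f.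
  move=> k mo mof; have := rsupp_filter mof; have := rsupp_filter2 hu mof.
  by rewrite /P /= => /orP [-> //|].
have [||w [dw hw ew]] := IH (kconst _ f) (kdeg_const _ _); rewrite ?kconstK //.
  exact: rsupp_filter2.
exists (w, kconst _ g); split=> /=.
- by split=> //; apply: kdeg_const.
- split=> //; apply: kall_const; first exact: rsupp0.
  by apply: (homX_inv (t := t)); rewrite -eg; apply: rsupp_filter2.
- rewrite -ew kd_const oppr0 -linearZ -linearD /= addrC -eu.
  by rewrite kcoef0K.
Qed.

(** The variables form a regular sequence. In the cone (u, v) the component v is a
    cycle; if it has degree 0, then x_t v is a boundary and v is one because
    multiplying by x_t does not affect divisibility by the other variables.
    Removing v leaves a cycle of the smaller complex. *)
Lemma kos_exact m (degs : 'I_m -> nat) ts p a j (z : kos (kX ts) (rowmod m)) :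
    uniq ts -> kdeg p.+1 z -> kall (homog_row degs a j) z -> kd z = 0 ->
  exists w, [/\ kdeg p.+2 w, kall (homog_row degs a.+1 j) w & z = kd w].
Proof.
elim: ts p z => [|t ts IH] p /=.
  by move=> z _ -> _ _; exists 0; split=> //; exact: rsupp0.
case=> u v /= /andP [tts uts] [du dv] [hu hv] [e1 /eqP]; rewrite oppr_eq0 => /eqP e2.
have [v' [dv' hv' ev]] : exists v', [/\ kdeg p.+1 v', kall (homog_row degs a.+1 j) v' & v = kd v'].
  case: p du dv => [|p] du dv; last exact: IH.
  apply: hits_kcoef0_d => //; last exact: kall_coef0 hv.
  pose P (_ : 'I_m) (mo : mon) := has (fun t => (0 < mo t)%N) ts.
  apply: (@rsupp_mulX_inv K n m P P t (kcoef0 v)).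
    move=> k mo /hasP [s sts]; rewrite mnmDE mnm1E => s0; apply/hasP; exists s => //.
    by move: s0; case: eqP => [ts'|_]; [rewrite ts' sts in tts|rewrite addn0].
  have -> : 'X_t *: kcoef0 v = kcoef0 (kd (- u)).
    by rewrite -linearZ linearN /=; congr kcoef0; apply/eqP; rewrite -subr_eq0 opprK addrC e1.
  exact: kcoef0_d_hits.
have [_ kD kZ] := kdeg_submodule (rowmod m) (kX ts) p.+1.
have [_ hD _] := @kall_additive _ (rowmod m) _ (kX ts) (hom_additive degs a j).
have [|||w [dw hw ew]] := IH p (u + 'X_t *: v') uts.
- by apply: kD => //; apply: kZ.
- by apply: hD => //; apply: kallZ hv' => w; apply: homX.
- by rewrite kdD kdZ -ev e1.
exists (w, - v'); split=> /=.
- split=> //; rewrite -scaleN1r; exact: kZ.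
- split=> //; have [_ _ hN] := @kall_additive _ (rowmod m) _ (kX ts) (hom_additive degs a.+1 j).
  exact: hN.
- by rewrite -ew scalerN addrK kdN opprK -ev.
Qed.

(** H_p(x; N/Z) vanishes in total degree j. Working with a pair of
    submodules of a free module covers both S/I and the syzygy modules. *)
Definition koszul_vanish m (degs : 'I_m -> nat) (N Z : 'rV[S]_m -> Prop) ts p j : Prop :=
  forall z : kos (kX ts) 'rV[S]_m,
    kdeg p z -> kall N z -> kall (homog_row degs p j) z -> kall Z (kd z) ->
  exists w, [/\ kdeg p.+1 w, kall N w, kall (homog_row degs p.+1 j) w & kall Z (z - kd w)].

Lemma koszul_vanish_eq m (degs : 'I_m -> nat) (N N' Z Z' : 'rV[S]_m -> Prop) ts p j :
    (forall u, N u <-> N' u) -> (forall u, Z u <-> Z' u) ->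
  koszul_vanish degs N Z ts p j -> koszul_vanish degs N' Z' ts p j.
Proof.
move=> eN eZ V z dz Nz hz Zz.
have [||w [dw Nw hw Zw]] := V z dz _ hz _.
- by apply: kall_impl Nz => u /eN.
- by apply: kall_impl Zz => u /eZ.
by exists w; split=> //; [apply: kall_impl Nw => u /eN|apply: kall_impl Zw => u /eZ].
Qed.

(** The rows of D are homogeneous generators of N modulo Z, and [cover_min] says
    that the syzygies between them have coefficients in the maximal ideal m. *)
Record min_cover m (degs : 'I_m -> nat) (N Z : 'rV[S]_m -> Prop)
    m' (degs' : 'I_m' -> nat) (D : 'M[S]_(m', m)) : Prop := MinCover {
  cover_N : submodule_pred N;
  cover_Z : submodule_pred Z;
  cover_gr : forall a j u, Z u -> Z (rfilter (has_degree degs a j) u);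
  cover_im : forall w, N (w *m D);
  cover_onto : forall u, N u -> exists w, Z (u - w *m D);
  cover_hom : forall k l mo, mo \in msupp (D k l) -> (mdeg mo + degs l = degs' k)%N;
  cover_min : forall w, Z (w *m D) -> forall k, (w 0 k)@_0%MM = 0 }.

(** A homogeneous matrix maps homogeneous components to homogeneous components,
    whence exactness can be used degree by degree. *)
Lemma rfilter_mulmx m m' (degs : 'I_m -> nat) (degs' : 'I_m' -> nat) (D : 'M[S]_(m', m)) a j w :
    (forall k l mo, mo \in msupp (D k l) -> (mdeg mo + degs l = degs' k)%N) ->
  rfilter (has_degree degs a j) (w *m D) = rfilter (has_degree degs' a j) w *m D.
Proof.
move=> hD; rewrite {1}(rfilter_split (has_degree degs' a j) w) mulmxDl rfilterD.
have suppM u l mo : mo \in msupp ((u *m D) 0 l) ->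
    exists k m1 m2, [/\ m1 \in msupp (u 0 k), m2 \in msupp (D k l) & mo = (m1 + m2)%MM].
  rewrite mxE => /msupp_sum_le /flattenP [s /mapP [k _ ->]] /msuppM_ex [m1 [m2 [? ? ?]]].
  by exists k, m1, m2.
have eqd k l m1 m2 : m2 \in msupp (D k l) ->
    has_degree degs a j l (m1 + m2)%MM = has_degree degs' a j k m1.
  by move=> /hD e; rewrite /has_degree mdegD -e; congr (_ == _); lia.
rewrite [X in X + _]rfilter_id ?[X in _ + X]rfilter_none ?addr0 //.
  move=> l mo /suppM [k [m1 [m2 [m1w m2D ->]]]]; rewrite (eqd _ _ _ _ m2D).
  exact: (rsupp_filter m1w).
move=> l mo /suppM [k [m1 [m2 [m1w m2D ->]]]]; rewrite (eqd _ _ _ _ m2D).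
exact: (rsupp_filter m1w).
Qed.

Section Shift.
Variables (m : nat) (degs : 'I_m -> nat) (N Z : 'rV[S]_m -> Prop).
Variables (m' : nat) (degs' : 'I_m' -> nat) (D : 'M[S]_(m', m)).
Hypothesis cov : min_cover degs N Z degs' D.
Variables (ts : seq 'I_n) (uts : uniq ts) (fts : forall t, t \in ts).
Local Notation N' := (fun w : 'rV[S]_m' => Z (w *m D)).
Local Notation Z0 := (fun w : 'rV[S]_m' => w = 0).
Local Notation f := (@mulmxr S 1 m' m D).

Lemma cover_hom_mul a j w : homog_row degs' a j w -> homog_row degs a j (w *m D).
Proof.
move=> hw; rewrite -(rfilter_id hw) -(rfilter_mulmx _ _ _ (cover_hom cov)).
exact: rsupp_filter.
Qed.

Lemma cover_lift a j u : N u -> homog_row degs a j u ->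
  exists2 w, homog_row degs' a j w & Z (u - w *m D).
Proof.
move=> /(cover_onto cov) [w Zw] hu; exists (rfilter (has_degree degs' a j) w).
  exact: rsupp_filter.
rewrite -(rfilter_mulmx _ _ _ (cover_hom cov)) -[X in Z (X - _)](rfilter_id hu).
rewrite -rfilterB.
exact: (cover_gr cov).
Qed.

Lemma kos_cover_lift p a j (z : kos (kX ts) (rowmod _)) : kdeg p z -> kall N z ->
  kall (homog_row degs a j) z ->
  exists y, [/\ kdeg p y, kall (homog_row degs' a j) y & kall Z (z - kmap f y)].
Proof.
move=> dz Nz hz.
apply: (@kos_lift _ _ _ f (fun u => N u /\ homog_row degs a j u)) => //.
- by case: (cover_Z cov).
- exact: rsupp0.
- by rewrite linear0.
- by move=> u [Nu hu]; apply: cover_lift.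
- by elim: (ts) z Nz hz {dz} => [|t ts' IH] //= z [? ?] [? ?]; split; apply: IH.
Qed.

Lemma minimal_hits w : N' w -> hits ts w.
Proof.
move=> /(cover_min cov) w0 k mo mow; apply/hasP.
have [|t t0] := @mnm_neq0 _ mo; last by exists t.
by apply/eqP=> mo0; move: mow; rewrite mcoeff_msupp mo0 w0 eqxx.
Qed.

(** Cycles with syzygies as coefficients bound in the free module: for p > 0 since
    the Koszul complex is exact, for p = 0 since syzygies lie in m F. *)
Lemma kos_syzygy_d p j (z : kos (kX ts) (rowmod _)) : kdeg p z ->
    kall N' z -> kall (homog_row degs' p j) z -> kd z = 0 ->
  exists w, [/\ kdeg p.+1 w, kall (homog_row degs' p.+1 j) w & z = kd w].
Proof.
case: p => [|p] dz Nz hz cz; last exact: kos_exact.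
apply: hits_kcoef0_d => //; last exact: kall_coef0 hz.
exact/minimal_hits/(kall_coef0 Nz).
Qed.

Let sZ := cover_Z cov.
Let kZadd := @kall_additive _ (rowmod m) _ (kX ts) (submodule_additive sZ).

(** With the syzygy module N' one has the exact sequence 0 -> N' -> F -> N/Z -> 0.
    The connecting map H_(p+1)(N/Z) -> H_p(N') is onto, because H_p(N') -> H_p(F)
    is zero; the proof is the corresponding diagram chase. *)
Lemma koszul_shift p j :
  koszul_vanish degs N Z ts p.+1 j -> koszul_vanish degs' N' Z0 ts p j.
Proof.
move=> V z dz Nz hz /kall_eq0 cz.
have [w [dw hw ew]] := kos_syzygy_d dz Nz hz cz.
have [||||v [dv Nv hv Zv]] := V (kmap f w).
- by apply: kdeg_map => //; rewrite linear0.
- by apply: kall_map (kallT w (fun=> I)) => u _; apply: (cover_im cov).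
- by apply: kall_map hw => u; apply: cover_hom_mul.
- by rewrite kd_map -ew; apply: kall_map Nz => u.
have [v' [dv' hv' Zv']] := kos_cover_lift dv Nv hv.
exists (w - kd v'); split.
- by apply: submodule_predB (kdeg_submodule _ _ _) dw (kdeg_d dv').
- apply: (@kall_map_inv _ _ _ f _ Z) => //.
  have -> : kmap f (w - kd v') = kmap f w - kd v + kd (v - kmap f v').
    by rewrite !linearB /= kd_map addrA subrK.
  by case: kZadd => _ + _; apply=> //; apply: kall_d_sub.
- apply: additive_predB (kall_additive _ (hom_additive _ _ _)) hw _.
  exact: kall_hom_d.
- by rewrite linearB /= kd_kd subr0 ew subrr; apply: kall0.
Qed.

(** The connecting map H_(p+1)(N/Z) -> H_p(N') is injective as H_(p+1)(F) = 0. *)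
Lemma koszul_unshift p j :
  koszul_vanish degs' N' Z0 ts p j -> koszul_vanish degs N Z ts p.+1 j.
Proof.
move=> V z dz Nz hz Zz.
have [y [dy hy Zy]] := kos_cover_lift dz Nz hz.
have [||||w [dw Nw hw /kall_eq0/eqP]] := V (kd y).
- exact: kdeg_d.
- apply: (@kall_map_inv _ _ _ f _ Z) => //; rewrite -kd_map.
  rewrite -[kmap f y](subKr z) linearB /=.
  by apply: additive_predB kZadd Zz _; apply: kall_d_sub.
- exact: kall_hom_d.
- by rewrite kd_kd; apply: kall0.
rewrite -linearB /= => /eqP e.
have [||v [dv hv ev]] := kos_exact (degs := degs') (p := p) (a := p.+1) (j := j) uts _ _ e.
- by apply: submodule_predB (kdeg_submodule _ _ _) dy dw.
- exact: additive_predB (kall_additive _ (hom_additive _ _ _)) hy hw.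
exists (kmap f v); split.
- by apply: kdeg_map dv; rewrite linear0.
- by apply: kall_map (kallT v (fun=> I)) => u _; apply: (cover_im cov).
- by apply: kall_map hv => u; apply: cover_hom_mul.
- rewrite kd_map -ev linearB opprB addrCA addrC.
  by case: kZadd => _ + _; apply=> //; apply: kall_map Nw.
Qed.

(** If H_0(N/Z) vanishes in degree j, then the image of a basis vector b of degree
    j lies in m N + Z, and b is congruent modulo m F to a syzygy; but syzygies
    have no constant coefficients. *)
Lemma koszul_no_generator j k : koszul_vanish degs N Z ts 0 j -> degs' k <> j.
Proof.
move=> V ek; pose b : 'rV[S]_m' := delta_mx 0 k.
have hb : homog_row degs' 0 j b.
  move=> l mo; rewrite mxE eqxx /=; case: eqP => [->|_]; last by rewrite msupp0.
  by rewrite msupp1 inE => /eqP ->; rewrite /has_degree mdeg0 ek addn0.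
have N0 : N 0 by case: (cover_N cov).
have [||||w [dw Nw hw]] := V (kconst _ (b *m D)).
- exact: kdeg_const.
- by apply: kall_const => //; apply: (cover_im cov).
- by apply: kall_const; [exact: rsupp0|exact: cover_hom_mul].
- by rewrite kd_const; apply: kall0; case: sZ.
have [v [dv hv Zv]] := kos_cover_lift dw Nw hw.
move=> /kall_coef0; rewrite linearB /= kconstK => Zb.
have := @cover_min _ _ _ _ _ _ _ cov (b - kcoef0 (kd v)) _ k.
rewrite !mxE !eqxx mcoeffB mcoeff1 eqxx.
have -> : (kcoef0 (kd v) 0 k)@_0%MM = 0.
  apply: memN_msupp_eq0; apply/negP=> /kcoef0_d_hits /hasP [t _].
  by rewrite mnm0E.
rewrite subr0 => one0; have /eqP := oner_neq0 K; apply; apply: one0.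
have ef : kcoef0 (kmap f (kd v)) = kcoef0 (kd v) *m D.
  by elim: (kX ts) (kd v) => [|x xs IH] //= [].
rewrite mulmxBl -ef -kd_map.
have -> : b *m D - kcoef0 (kd (kmap f v)) =
   (b *m D - kcoef0 (kd w)) + kcoef0 (kd (w - kmap f v)).
  by rewrite !linearB /= addrA subrK.
by case: sZ => _ + _; apply=> //; apply: kall_coef0; apply: kall_d_sub.
Qed.

(** Without generators of degree j, every element of degree j is a combination of
    generators with nonconstant homogeneous coefficients. *)
Lemma koszul_generator j : (forall k, degs' k <> j) -> koszul_vanish degs N Z ts 0 j.
Proof.
move=> nok z dz Nz hz _.
have [w hw Zw] := cover_lift (kall_coef0 Nz) (kall_coef0 hz).
have [||y [dy hy ey]] := hits_kcoef0_d (degs := degs') (a := 0) (j := j) (kdeg_const (kX ts) w).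
- rewrite kconstK => k mo /hw; rewrite /has_degree => /eqP e; apply/hasP.
  have [|t t0] := @mnm_neq0 _ mo; last by exists t.
  by apply/eqP=> mo0; case: (nok k); rewrite -e mo0 mdeg0 addn0.
- by rewrite kconstK.
exists (kmap f y); split.
- by apply: kdeg_map dy; rewrite linear0.
- by apply: kall_map (kallT y (fun=> I)) => u _; apply: (cover_im cov).
- by apply: kall_map hy => u; apply: cover_hom_mul.
rewrite kd_map -ey kmap_const -{1}(kcoef0K dz) -linearB /=.
by apply: kall_const => //; case: sZ.
Qed.

End Shift.
End Graded.
Arguments hom_additive {K n m}.

(** * Minimal generators of a graded submodule *)

Section Generators.
Variables (K : fieldType) (n m : nat) (degs : 'I_m -> nat).
Local Notation S := {mpoly K[n]}.
Local Notation mon := 'X_{1..n}.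
Local Notation kX ts := [seq ('X_t : S) | t <- ts].
Local Notation rowmod m := (matrix_matrix__canonical__GRing_Lmodule _ 1 m).
Variable N : 'rV[S]_m -> Prop.
Hypothesis sN : submodule_pred N.
Hypothesis grN : forall a j u, N u -> N (rfilter (has_degree degs a j) u).

(** This is m N, for m the ideal of the variables. *)
Definition max_mul (u : 'rV[S]_m) : Prop :=
  exists g : 'I_n -> 'rV[S]_m, (forall t, N (g t)) /\ u = \sum_t 'X_t *: g t.

Lemma max_mul_submodule : submodule_pred max_mul.
Proof.
have [N0 ND NZ] := sN.
split.
- by exists (fun=> 0); split=> //; rewrite big1 // => t _; rewrite scaler0.
- move=> u v [g [Ng ->]] [h [Nh ->]]; exists (fun t => g t + h t).
  split=> [t|]; first exact: ND.
  by rewrite -big_split; apply: eq_bigr => t _; rewrite scalerDr.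
- move=> a u [g [Ng ->]]; exists (fun t => a *: g t); split=> [t|]; first exact: NZ.
  by rewrite scaler_sumr; apply: eq_bigr => t _; rewrite !scalerA mulrC.
Qed.

Lemma max_mulX t u : N u -> max_mul ('X_t *: u).
Proof.
move=> Nu; exists (fun s => if s == t then u else 0); split=> [s|].
  by case: eqP => // _; case: sN.
rewrite (bigD1 t) //= eqxx big1 ?addr0 // => s /negPf->.
by rewrite scaler0.
Qed.

Lemma max_mul_nonunit (f : S) u : f@_0%MM = 0 -> N u -> max_mul (f *: u).
Proof.
move=> f0 Nu; have [M0 MD MZ] := max_mul_submodule; have [_ _ NZ] := sN.
rewrite [f]mpolyE scaler_suml big_seq; apply: big_ind => // mo mof.
have mo0 : mo != 0%MM.
  by apply/eqP=> e; move: mof; rewrite e mcoeff_msupp f0 eqxx.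
have [t t0] := mnm_neq0 mo0.
have -> : f@_mo *: 'X_[mo] = 'X_t * (f@_mo *: 'X_[mo - U_(t)]).
  rewrite -scalerAr -mpolyXD addmC submK //.
  by apply/mnm_lepP => s; rewrite mnm1E; case: eqP => // <-.
by rewrite -scalerA; apply/max_mulX/NZ.
Qed.

Lemma max_mul_d ts (w : kos (kX ts) (rowmod m)) : kall N w -> max_mul (kcoef0 (kd w)).
Proof.
have [M0 MD _] := max_mul_submodule.
elim: ts w => [|t ts IH] //= [u v] [/= Nu Nv]; rewrite linearD linearZ /=.
by apply: MD; [exact: IH|exact/max_mulX/(kall_coef0 Nv)].
Qed.

Definition independent_family (B k : nat) (g : 'I_k -> 'rV[S]_m) (d : 'I_k -> nat) : Prop :=
  [/\ forall i, N (g i), forall i, homog_row degs 0 (d i) (g i), forall i, (d i <= B)%N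
    & forall c : 'I_k -> K, max_mul (\sum_i (c i)%:MP *: g i) -> forall i, c i = 0].

(** Independence modulo m N implies independence in the space of rows of degree at
    most B, which has finite dimension. *)
Lemma independent_family_bound B k g d : @independent_family B k g d ->
  (k <= #|{: 'I_m * 'X_{1..n < B.+1}}|)%N.
Proof.
case=> Ng hg dB ind; rewrite leqNgt; apply/negP=> ltk.
pose T := ('I_m * 'X_{1..n < B.+1})%type.
pose A := \matrix_(i < k, q < #|{: T}|)
   (g i 0 (enum_val q).1)@_(bmnm (enum_val q).2).
have nfree : ~~ row_free A.
  by rewrite -row_leq_rank -ltnNge; apply: leq_ltn_trans (rank_leq_col _) ltk.
pose c := nz_row (kermx A).
have cA : c *m A = 0 by apply/sub_kermxP/nz_row_sub.
have /eqP : c != 0 by rewrite nz_row_eq0 kermx_eq0.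
apply; apply/rowP=> i; rewrite mxE; apply: (ind (fun i => c 0 i)).
suff -> : \sum_i (c 0 i)%:MP *: g i = 0 by case: max_mul_submodule.
apply/rowP=> l; apply/mpolyP=> mo; rewrite mxE summxE raddf_sum /= mcoeff0.
have [moB|moB] := ltnP (mdeg mo) B.+1; last first.
  apply: big1 => s _; rewrite mxE mcoeffCM memN_msupp_eq0 ?mulr0 //.
  apply/negP=> /hg; rewrite /has_degree addn0 => /eqP e.
  by have := dB s; rewrite -e; lia.
have := congr1 (fun M : 'rV[K]__ => M 0 (enum_rank (l, BMultinom moB))) cA.
rewrite !mxE => {2}<-; apply: eq_bigr => s _.
by rewrite !mxE mcoeffCM enum_rankK.
Qed.

Lemma rfilterZC P (c : K) u : rfilter P (c%:MP *: u) = c%:MP *: rfilter P u :> 'rV[S]_m.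
Proof.
apply/rowP=> k; apply/mpolyP=> mo; rewrite !mxE !(mcoeffCM, mcoeff_filter).
by case: (P k mo); rewrite // mulr0.
Qed.

Lemma max_mul_gr a j u : max_mul u -> max_mul (rfilter (has_degree degs a j) u).
Proof.
move=> [g [Ng ->]]; exists (fun t => rfilter (has_degree degs a.+1 j) (g t)).
split=> [t|]; first exact: grN.
rewrite rfilter_sum; apply: eq_bigr => t _; apply: rfilter_mulX => k mo.
exact: has_degree_mulX.
Qed.

Variable B : nat.
Variable ts : seq 'I_n.
Hypothesis van : forall j, (B < j)%N -> koszul_vanish degs N (fun u => u = 0) ts 0 j.

Lemma ex_maximal_family : exists k g d, @independent_family B k g d /\
  forall u j, N u -> (j <= B)%N -> homog_row degs 0 j u ->
    exists c, max_mul (u - \sum_i (c i)%:MP *: g i).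
Proof.
pose fam k := exists g d, @independent_family B k g d.
have fam0 : fam 0%N.
  exists (fun=> 0), (fun=> 0%N); split=> [|||c _] i; by [case: i|case: i|case: i].
have [k [[g [d gd]] nfam]] : exists k, fam k /\ ~ fam k.+1.
  apply: NNPP => no; have famk : forall k, fam k.
    by elim=> // k famk; apply: NNPP => nfam; apply: no; exists k.
  have [g [d /independent_family_bound]] := famk (#|{: 'I_m * 'X_{1..n < B.+1}}|).+1.
  by rewrite ltnn.
exists k, g, d; split=> // u j Nu jB hu; apply: NNPP => no.
apply: nfam; pose g' i := if unlift ord0 i is Some i' then g i' else u.
pose d' i := if unlift (ord0 : 'I_k.+1) i is Some i' then d i' else j.
case: gd => Ng hg dB ind; exists g', d'.
have [M0 MD MZ] := max_mul_submodule.
split=> [i|i|i|c]; rewrite /g' /d'; try by case: unliftP.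
rewrite big_ord_recl unlift_none; under eq_bigr do rewrite liftK.
have [c0|c0] := eqVneq (c ord0) 0.
  rewrite c0 scale0r add0r => /ind c'0 i.
  by case: (unliftP ord0 i) => [i'|] -> //; apply: c'0.
move=> /(MZ (c ord0)^-1%:MP); rewrite scalerDr scalerA -mpolyCM mulVf // scale1r.
move=> Mu; case: no; exists (fun i => - ((c ord0)^-1 * c (lift ord0 i))).
rewrite -sumrN; move: Mu; rewrite scaler_sumr.
under eq_bigr do rewrite scalerA -mpolyCM.
by under [X in _ -> max_mul (_ + X)]eq_bigr do rewrite mpolyCN scaleNr opprK.
Qed.

(** A maximal independent family generates N by the graded Nakayama lemma: N and
    m N agree in the degrees above B, where H_0 vanishes, and the family spans N
    modulo m N in the other ones. Its relations have coefficients in m because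
    their constant parts are relations modulo m N. Finite generation thus comes
    from the bound on the degrees of H_0, not from noetherianity. *)
Lemma ex_min_cover : exists m' (degs' : 'I_m' -> nat) (D : 'M[S]_(m', m)),
  min_cover degs N (fun u => u = 0) degs' D.
Proof.
have [k [g [d [[Ng hg dB ind] max]]]] := ex_maximal_family.
exists k, d, (\matrix_i g i); set D := \matrix_i g i.
have [N0 ND NZ] := sN; have [M0 MD MZ] := max_mul_submodule.
have mulD (w : 'rV[S]_k) : w *m D = \sum_i w 0 i *: g i.
  by rewrite mulmx_sum_row; apply: eq_bigr => i _; rewrite rowK.
pose im u := exists w : 'rV[S]_k, u = w *m D.
have im0 : im 0 by exists 0; rewrite mul0mx.
have imD u v : im u -> im v -> im (u + v).
  by move=> [w ->] [w' ->]; exists (w + w'); rewrite mulmxDl.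
have imZ a u : im u -> im (a *: u).
  by move=> [w ->]; exists (a *: w); rewrite -scalemxAl.
have img i : im (g i).
  exists (delta_mx 0 i); rewrite mulD (bigD1 i) //= big1 ?addr0 ?mxE ?eqxx ?scale1r //.
  by move=> i' /negPf ne; rewrite mxE eqxx ne scale0r.
have im_hom j : forall u, N u -> homog_row degs 0 j u -> im u.
  have [l lj] := ubnP j; elim: l j lj => // l IH j lj u Nu hu.
  (* Elements of m N have coefficients of smaller degree, where induction applies. *)
  have maxim v : max_mul v -> homog_row degs 0 j v -> im v.
    move=> [h [Nh ev]] hv; rewrite -(rfilter_id hv) ev rfilter_sum.
    apply: big_ind => // t _.
    rewrite (rfilter_mulX _ _ (P := has_degree degs 1 j)); last first.
      by move=> k' mo; rewrite has_degree_mulX.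
    apply: imZ; suff: forall y, N y -> homog_row degs 1 j y -> im y.
      by apply; [exact: grN|exact: rsupp_filter].
    case: j lj {hu hv} => [|j] lj y Ny hy.
      suff -> : y = 0 by [].
      by apply: rsupp_none hy => i mo; rewrite /has_degree addn1.
    apply: (IH j) => //.
    by apply: rsupp_impl hy => i mo; rewrite /has_degree addn1 addn0 eqSS.
  have [jB|Bj] := leqP j B; last first.
    have [||||w [_ Nw _ /kall_coef0]] := van Bj (z := kconst _ u).
    - exact: kdeg_const.
    - exact: kall_const.
    - by apply: kall_const => //; exact: rsupp0.
    - by rewrite kd_const; apply: kall0.
    rewrite linearB /= kconstK => /eqP; rewrite subr_eq0 => /eqP e.
    by apply: maxim => //; rewrite e; apply: max_mul_d.
  have [c Mc] := max u j Nu jB hu.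
  rewrite -(rfilter_id hu) -(subrK (\sum_i (c i)%:MP *: g i) u) rfilterD.
  apply: (imD).
    by apply: maxim; [exact: max_mul_gr|exact: rsupp_filter].
  rewrite rfilter_sum; apply: (big_ind im im0 imD) => i _; rewrite rfilterZC; apply: imZ.
  have [dj|dj] := eqVneq (d i) j; first by rewrite -dj rfilter_id //; exact: hg.
  rewrite rfilter_none // => s mo /hg /eqP e; apply/eqP=> e'.
  by rewrite -e -e' eqxx in dj.
split=> //; first exact: submodule_pred0.
- move=> a j u ->; apply: rfilter_none => s mo; rewrite mxE msupp0 //.
- by move=> w; rewrite mulD; apply: big_ind => // i _; apply: NZ.
- move=> u Nu; suff [w ->] : im u by exists w; rewrite subrr.
  have [J hJ] : exists J, forall (i : 'I_m) mo,
      mo \in msupp (u 0 i) -> (mdeg mo + degs i < J)%N.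
    exists (\max_(i < m) (msize (u 0%R i) + degs i))%N => i mo /msize_mdeg_lt lt.
    by apply: leq_trans (leq_bigmax i); rewrite ltn_add2r.
  (* Peel off the homogeneous components from the top degree J downwards. *)
  elim: J u Nu hJ => [|J IH] u Nu hJ.
    suff -> : u = 0 by [].
    by apply: (rsupp_none (P := fun _ => pred0)) => // i mo /hJ.
  rewrite (rfilter_split (has_degree degs 0 J) u); apply: imD.
    by apply: (im_hom J); [exact: grN|exact: rsupp_filter].
  set v := rfilter _ _; have ev : v = u - rfilter (has_degree degs 0 J) u.
    by apply/esym/eqP; rewrite subr_eq addrC; apply/eqP/rfilter_split.
  apply: IH; first by rewrite ev; apply: (submodule_predB sN) => //; apply: grN.
  move=> i mo mov; have := rsupp_filter mov; rewrite /= /has_degree addn0.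
  have /hJ : mo \in msupp (u 0 i).
    by move: mov; rewrite !mcoeff_msupp mxE mcoeff_filter; case: ifP; rewrite ?eqxx.
  by rewrite ltnS leq_eqVlt => /orP [->|].
- by move=> i l mo; rewrite mxE => /hg /eqP; rewrite addn0.
- move=> w; rewrite mulD => e i.
  apply: (ind (fun i => (w 0 i)@_0%MM)).
  have -> : \sum_i ((w 0 i)@_0%MM)%:MP *: g i
     = \sum_i (((w 0 i)@_0%MM)%:MP - w 0 i) *: g i.
    by under [RHS]eq_bigr do rewrite scalerBl; rewrite sumrB e subr0.
  apply: big_ind => // s _; apply: max_mul_nonunit => //.
  by rewrite mcoeffB mcoeffC eqxx mulr1 subrr.
Qed.

End Generators.

(** * Minimal free resolutions and Koszul homology *)

Section Resolutions.
Variables (K : fieldType) (n : nat).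
Local Notation S := {mpoly K[n]}.
Local Notation kX ts := [seq ('X_t : S) | t <- ts].
Local Notation rowmod m := (matrix_matrix__canonical__GRing_Lmodule _ 1 m).
Variables (ts : seq 'I_n) (uts : uniq ts) (fts : forall t, t \in ts).

Definition row_pred (I : S -> Prop) (u : 'rV[S]_1) : Prop := I (u 0 0).

(** S itself is treated as the module of rows of length one, generated in degree 0. *)
Definition deg0 (i : 'I_1) : nat := 0%N.

Definition quotient_vanish (I : S -> Prop) p j : Prop :=
  koszul_vanish deg0 (fun=> True) (row_pred I) ts p j.

Variable I : S -> Prop.
Hypothesis idI : is_ideal I.
Hypothesis grI : forall a j u, row_pred I u -> row_pred I (rfilter (has_degree deg0 a j) u).

Lemma row_pred_submodule : submodule_pred (row_pred I).
Proof.
case: idI => I0 ID IM; split=> [|u v|a u]; rewrite /row_pred mxE //.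
  exact: ID.
exact: IM.
Qed.

(** The kernel of F_i -> F_(i-1), or of F_0 -> S/I when i = 0. *)
Definition syzygies (F : free_sequence K n) i : 'rV[S]_(grank F i) -> Prop :=
  if i is i'.+1 return 'rV[S]_(grank F i) -> Prop
  then fun u => u *m gdiff F i' = 0 else fun u => row_pred I (u *m gaug F).

Section Given.
Variable F : free_sequence K n.
Hypothesis minF : minimal_graded_free_resolution I F.

Lemma gdiff_syzygies i u : syzygies u <-> exists w, u = w *m gdiff F i.
Proof.
by case: minF => _ [_ ex0 ex1] _; case: i u => [|i] u; [exact: ex0|exact: ex1].
Qed.

Lemma syzygies_nonunit i (u : 'rV_(grank F i)) : syzygies u -> forall k, (u 0 k)@_0%MM = 0.
Proof.
case: minF => _ _ mini /gdiff_syzygies [w ->] k.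
rewrite mxE raddf_sum big1 //= => l _.
by rewrite rmorphM /= mini mulr0.
Qed.

Lemma syzygies_submodule i : submodule_pred (@syzygies F i).
Proof.
have [I0 ID IZ] := row_pred_submodule.
case: i => [|i]; split=> [|u v|a u]; rewrite /syzygies.
all: rewrite ?mul0mx ?mulmxDl -?scalemxAl //.
- exact: ID.
- exact: IZ.
- by move=> -> ->; rewrite addr0.
- by move=> ->; rewrite scaler0.
Qed.

Lemma cover_aug : min_cover deg0 (fun=> True) (row_pred I) (@gdeg _ _ F 0) (gaug F).
Proof.
have [[_ homa] [onto _ _] _] := minF.
split=> //.
- exact: row_pred_submodule.
- by move=> u _; have [w Iw] := onto (u 0 0); exists w; rewrite /row_pred mxE [X in _ + X]mxE.
- move=> k l mo; rewrite ord1 => mok; rewrite addn0.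
  by have /dhomogP := homa k; apply.
- exact: (@syzygies_nonunit 0).
Qed.

Lemma cover_diff i :
  min_cover (@gdeg _ _ F i) (@syzygies F i) (fun u => u = 0) (@gdeg _ _ F i.+1) (gdiff F i).
Proof.
have [[homd _] _ _] := minF.
split.
- exact: syzygies_submodule.
- exact: submodule_pred0.
- by move=> a j u ->; apply: rfilter_none => k mo; rewrite mxE msupp0.
- by move=> w; apply/gdiff_syzygies; exists w.
- by move=> u /gdiff_syzygies [w ->]; exists w; rewrite subrr.
- move=> k l mo; have := homd i k l; case: leqP => [le /dhomogP h /h -> |_ /eqP ->].
    by rewrite subnK.
  by rewrite msupp0.
- exact: (@syzygies_nonunit i.+1).
Qed.

(** H_p of the module covered by F_i: this is S/I for i = 0, and the kernel of
    F_(i-1) -> F_(i-2) afterwards, where F_(-1) = S/I. *)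
Definition stage_vanish i p j : Prop :=
  if i is i'.+1
  then koszul_vanish (@gdeg _ _ F i') (@syzygies F i') (fun u => u = 0) ts p j
  else quotient_vanish I p j.

Lemma stage_vanish_shift i p j : stage_vanish i p.+1 j <-> stage_vanish i.+1 p j.
Proof.
case: i => [|i] /=; split.
- exact: (koszul_shift cover_aug uts fts).
- exact: (koszul_unshift cover_aug uts).
- exact: (koszul_shift (cover_diff i) uts fts).
- exact: (koszul_unshift (cover_diff i) uts).
Qed.

(** Shifting i times moves H_i(S/I) to H_0 of the module covered by F_i, where
    generators can be read off. *)
Lemma stage_vanish0 i j : quotient_vanish I i j <-> stage_vanish i 0 j.
Proof.
suff H k p : stage_vanish k p j <-> stage_vanish 0 (p + k) j by rewrite (H i 0%N).
elim: k p => [|k IH] p; first by rewrite addn0.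
by rewrite -stage_vanish_shift IH addnS.
Qed.

Theorem vanish_no_generator i j (k : 'I_(grank F i)) :
  quotient_vanish I i j -> gdeg k <> j.
Proof.
move/stage_vanish0; case: i k => [|i] k.
  exact: (koszul_no_generator cover_aug).
exact: (koszul_no_generator (cover_diff i)).
Qed.

Theorem generator_nonvanish i j :
  ~ quotient_vanish I i j -> exists k : 'I_(grank F i), gdeg k = j.
Proof.
move=> nV; apply: NNPP => no; apply: nV; apply/stage_vanish0.
have nok (k : 'I_(grank F i)) : gdeg k <> j by move=> e; apply: no; exists k.
case: i no nok => [|i] _ nok.
  exact: (koszul_generator cover_aug fts nok).
exact: (koszul_generator (cover_diff i) fts nok).
Qed.

End Given.

(** A syzygy module in the course of the construction of a resolution. [st_van]
    bounds the degrees of its generators and is what survives passing to the next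
    syzygy module, by dimension shifting; the bound B grows by one each time. *)
Record stage := Stage {
  st_rank : nat;
  st_degs : 'I_st_rank -> nat;
  st_mod : 'rV[S]_st_rank -> Prop;
  st_sub : submodule_pred st_mod;
  st_gr : forall a j u, st_mod u -> st_mod (rfilter (has_degree st_degs a j) u);
  st_min : forall u, st_mod u -> forall k, (u 0 k)@_0%MM = 0;
  st_van : exists B, forall p j, (B + p < j)%N ->
    koszul_vanish st_degs st_mod (fun u => u = 0) ts p j }.

Record next_cover (s : stage) := NextCover {
  nc_rank : nat;
  nc_degs : 'I_nc_rank -> nat;
  nc_mx : 'M[S]_(nc_rank, st_rank s);
  nc_cover : min_cover (@st_degs s) (@st_mod s) (fun u => u = 0) nc_degs nc_mx }.

Lemma ex_next_cover (s : stage) : inhabited (next_cover s).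
Proof.
have [B van] := st_van s.
have [|m' [degs' [D cov]]] := @ex_min_cover K n _ _ _ (st_sub s) (@st_gr s) B ts.
  by move=> j Bj; apply: van; rewrite addn0.
by constructor; exists m' degs' D.
Qed.

Definition cover_of (s : stage) : next_cover s :=
  epsilon (ex_next_cover s) (fun=> True).

Lemma kernel_sub m m' (D : 'M[S]_(m', m)) :
  submodule_pred (fun w : 'rV[S]_m' => w *m D = 0).
Proof.
split=> [|u v eu ev|a u eu]; first by rewrite mul0mx.
  by rewrite mulmxDl eu ev addr0.
by rewrite -scalemxAl eu scaler0.
Qed.

Lemma kernel_gr m (degs : 'I_m -> nat) N m' (degs' : 'I_m' -> nat) (D : 'M[S]_(m', m)) a j w :
  min_cover degs N (fun u => u = 0) degs' D ->
  w *m D = 0 -> rfilter (has_degree degs' a j) w *m D = 0.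
Proof.
move=> cov e; rewrite -(rfilter_mulmx _ _ _ (cover_hom cov)) e.
by apply: rfilter_none => k mo; rewrite mxE msupp0.
Qed.

Lemma kernel_van (s : stage) (c : next_cover s) :
  exists B, forall p j, (B + p < j)%N ->
    koszul_vanish (@nc_degs s c) (fun w => w *m nc_mx c = 0) (fun u => u = 0) ts p j.
Proof.
have [B van] := st_van s; exists B.+1 => p j Bj.
by apply: (koszul_shift (nc_cover c)) => //; apply: van; rewrite addnS -addSn.
Qed.

Definition next_stage (s : stage) : stage :=
  let c := cover_of s in
  Stage (kernel_sub (nc_mx c)) (fun a j u => @kernel_gr _ _ _ _ _ _ a j u (nc_cover c))
    (cover_min (nc_cover c)) (kernel_van c).

Hypothesis nonunitI : forall f, I f -> f@_0%MM = 0.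
Hypothesis vanI : exists B, forall p j, (B + p < j)%N -> quotient_vanish I p j.

(** S -> S/I is a minimal cover, with I as its syzygy module. *)
Lemma cover_unit : min_cover deg0 (fun=> True) (row_pred I) deg0 1%:M.
Proof.
split=> //.
- exact: row_pred_submodule.
- move=> u _; exists u; rewrite mulmx1 subrr /row_pred mxE.
  by case: idI.
- by move=> k l mo; rewrite !ord1 mxE msupp1 inE => /eqP ->; rewrite mdeg0.
- by move=> w; rewrite mulmx1 => /nonunitI w0 k; rewrite ord1.
Qed.

Lemma first_van : exists B, forall p j, (B + p < j)%N ->
  koszul_vanish deg0 (row_pred I) (fun u => u = 0) ts p j.
Proof.
have [B van] := vanI; exists B.+1 => p j Bj.
apply: koszul_vanish_eq (koszul_shift cover_unit uts fts (van p.+1 j _)) => //.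
  by move=> u; rewrite mulmx1.
by rewrite addnS -addSn.
Qed.

Lemma first_min u : row_pred I u -> forall k, (u 0 k)@_0%MM = 0.
Proof. by move=> /nonunitI u0 k; rewrite ord1. Qed.

Definition first_stage : stage :=
  Stage row_pred_submodule grI first_min first_van.

Definition stages i : stage := iter i next_stage first_stage.

Definition min_resolution : free_sequence K n :=
  @FreeSequence K n (fun i => st_rank (stages i)) (fun i => @st_degs (stages i))
    (fun i => nc_mx (cover_of (stages i))) 1%:M.

(** The resolution is minimal at every step because the rows of the i-th matrix
    belong to a syzygy module, and these lie in m F by [st_min]. *)
Theorem min_resolutionP : minimal_graded_free_resolution I min_resolution.
Proof.
have cov i := nc_cover (cover_of (stages i)).
split.
- split=> [i k l|k] /=; last first.
    by rewrite !ord1 mxE; exact: dhomog1.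
  have h := cover_hom (cov i) (k := k) (l := l).
  case: leqP => [le|lt].
    by apply/dhomogP => mo /h <-; rewrite addnK.
  apply/eqP/msuppnil0; case E: (msupp _) => [|mo s] //.
  by have := h mo; rewrite E mem_head => /(_ isT) e; move: lt; rewrite /= -e; lia.
- split=> [h|u|i u] /=.
  + by exists (const_mx h); rewrite mulmx1 mxE subrr; case: idI.
  + rewrite mulmx1; split.
      by move=> /(cover_onto (cov 0%N)) [w /eqP]; rewrite subr_eq0 => /eqP ->; exists w.
    by move=> [w ->]; apply: (cover_im (cov 0%N)).
  + split.
      by move=> /(cover_onto (cov i.+1)) [w /eqP]; rewrite subr_eq0 => /eqP ->; exists w.
    by move=> [w ->]; apply: (cover_im (cov i.+1)).
- move=> i k l /=.
  have := cover_im (cov i) (delta_mx 0 k).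
  by rewrite -rowE => /(@st_min (stages i)) /(_ l); rewrite mxE.
Qed.

End Resolutions.

(** * Koszul homology of quotients by monomial ideals *)

Section MonomialIdeals.
Variables (K : fieldType) (n : nat).
Local Notation S := {mpoly K[n]}.
Local Notation mon := 'X_{1..n}.
Local Notation kX ts := [seq ('X_t : S) | t <- ts].
Local Notation rowmod m := (matrix_matrix__canonical__GRing_Lmodule _ 1 m).
Variables (ts : seq 'I_n) (uts : uniq ts) (fts : forall t, t \in ts).

Definition mono_ideal (J : pred mon) (f : S) : Prop := forall mo, mo \in msupp f -> J mo.

Definition up_closed (J : pred mon) : Prop := forall m1 m2, J m1 -> J (m1 + m2)%MM.

Lemma mono_ideal_row J (u : 'rV[S]_1) :
  row_pred (mono_ideal J) u <-> rsupp (fun=> J) u.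
Proof.
split=> [Ju k mo|Ju mo]; last exact: Ju.
by rewrite (ord1 k); apply: Ju.
Qed.

Lemma mono_ideal_is_ideal J : up_closed J -> is_ideal (mono_ideal J).
Proof.
move=> upJ; split.
- by move=> mo; rewrite msupp0.
- by move=> f g Jf Jg mo /msuppD_le; rewrite mem_cat => /orP [/Jf|/Jg].
- move=> f g Jg mo /msuppM_ex [m1 [m2 [_ /Jg J2 ->]]].
  by rewrite addmC; apply: upJ.
Qed.

Lemma mono_ideal_gr J a j u : row_pred (mono_ideal J) u ->
  row_pred (mono_ideal J) (rfilter (has_degree deg0 a j) u).
Proof. by rewrite !mono_ideal_row; apply: rsupp_filter2. Qed.

(** The monomials of (I : x_t), and those of (I, x_t) below. *)
Definition colon_pred (J : pred mon) t : pred mon := fun mo => J (mo + U_(t))%MM.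
Definition add_var_pred (J : pred mon) t : pred mon := fun mo => J mo || (0 < mo t)%N.

Definition mono_vanish (J : pred mon) p j := quotient_vanish ts (@mono_ideal J) p j.

Lemma mono_vanish_eq J J' p j : J =1 J' -> mono_vanish J p j -> mono_vanish J' p j.
Proof.
move=> e; apply: koszul_vanish_eq => // u; rewrite !mono_ideal_row.
by split=> Ju k mo /Ju; rewrite e.
Qed.

(** An element of (I, x_t) is x_t v modulo I, and v is homogeneous because it comes
    from the monomials outside I. *)
Lemma split_off_var J t a j (u : 'rV[S]_1) :
    rsupp (fun=> add_var_pred J t) u -> homog_row deg0 a j.+1 u ->
  exists2 v, homog_row deg0 a j v & row_pred (mono_ideal J) (u - 'X_t *: v).
Proof.
move=> Ju hu; pose u' := rfilter (fun=> predC J) u.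
have [v ev] : exists v, u' = 'X_t *: v.
  apply: rdivX => k mo mou; have := rsupp_filter mou.
  by have /= := rsupp_filter2 Ju mou => /orP [->|].
exists v.
  have : homog_row deg0 a.+1 j.+1 v by apply: (homX_inv (t := t)); rewrite -ev; apply: rsupp_filter2.
  by apply: rsupp_impl => k mo; rewrite /has_degree addnS eqSS.
rewrite -ev mono_ideal_row {1}(rfilter_split (fun=> J) u) addrK.
exact: rsupp_filter.
Qed.

Lemma kos_split_off_var J t p a j (z : kos (kX ts) (rowmod 1)) :
    kdeg p z -> kall (row_pred (mono_ideal (add_var_pred J t))) z ->
    kall (homog_row deg0 a j.+1) z ->
  exists y, [/\ kdeg p y, kall (homog_row deg0 a j) y & kall (row_pred (mono_ideal J)) (z - 'X_t *: y)].
Proof.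
move=> dz Jz hz.
have lft u : row_pred (mono_ideal (add_var_pred J t)) u /\ homog_row deg0 a j.+1 u ->
    exists2 v, homog_row deg0 a j v & row_pred (mono_ideal J) (u - 'X_t *: v).
  by case=> /mono_ideal_row ? ?; apply: split_off_var.
have [||||y [dy hy Jy]] := kos_lift _ _ _ lft dz.
- by rewrite mono_ideal_row; exact: rsupp0.
- exact: rsupp0.
- by rewrite scaler0.
- by elim: (ts) z Jz hz {dz} => [|s ts' IH] //= z [? ?] [? ?]; split; apply: IH.
by exists y; split=> //; rewrite -kmap_scale.
Qed.

Lemma mono_additive J :
  additive_pred (@kall _ (rowmod 1) (row_pred (mono_ideal J)) (kX ts)).
Proof.
apply: kall_additive; split=> [|u v|u]; rewrite !mono_ideal_row.
- exact: rsupp0.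
- by have [_ + _] := rsupp_additive K (fun _ : 'I_1 => J); apply.
- by have [_ _] := rsupp_additive K (fun _ : 'I_1 => J); apply.
Qed.

Lemma mono_submodule J : up_closed J -> submodule_pred (row_pred (mono_ideal J)).
Proof. by move=> upJ; apply/row_pred_submodule/mono_ideal_is_ideal. Qed.

Lemma kall_colon J t (z : kos (kX ts) (rowmod 1)) :
  kall (row_pred (mono_ideal J)) ('X_t *: z) <-> kall (row_pred (mono_ideal (colon_pred J t))) z.
Proof.
rewrite -kmap_scale; split.
  by apply: kall_map_inv => u; rewrite !mono_ideal_row; apply: rsupp_mulX_inv.
by apply: kall_map => u; rewrite !mono_ideal_row; apply: rsupp_mulX.
Qed.

Lemma add_var_up J t : up_closed J -> up_closed (add_var_pred J t).
Proof.
move=> upJ m1 m2 /orP [/upJ J1|]; first by apply/orP; left; apply: J1.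
by rewrite /add_var_pred mnmDE addn_gt0 => ->; rewrite orbT.
Qed.

Lemma kall_hom_dX p j ts' (z : kos (kX ts') (rowmod 1)) t :
  kall (homog_row deg0 p j) z -> kall (homog_row deg0 p j.+1) ('X_t *: z).
Proof.
apply: kallZ => u hu; apply: homX.
by apply: rsupp_impl hu => k mo; rewrite /has_degree addnS eqSS.
Qed.

(** The exact sequence 0 -> S/(I : x_t)(-1) -> S/I -> S/(I, x_t) -> 0, as a chase:
    a cycle bounds modulo (I, x_t), the error is x_t b with b a cycle modulo
    (I : x_t), and b bounds there. *)
Lemma vanish_colon J t p j : up_closed J ->
  mono_vanish (colon_pred J t) p j -> mono_vanish (add_var_pred J t) p j.+1 ->
  mono_vanish J p j.+1.
Proof.
move=> upJ Vc Vx z dz _ hz Jz; have [_ JD JN] := mono_additive J.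
have sJ := mono_submodule upJ.
have [||||w [dw _ hw Jw]] := Vx z => //; first exact: kallT.
  by apply: kall_impl Jz => u; rewrite !mono_ideal_row => Ju k mo /Ju; rewrite /add_var_pred => ->.
have hz' : kall (homog_row deg0 p j.+1) (z - kd w).
  exact: additive_predB (kall_additive _ (hom_additive _ _ _)) hz (kall_hom_d hw).
have dz' : kdeg p (z - kd w).
  exact: submodule_predB (kdeg_submodule _ _ _) dz (kdeg_d dw).
have [b [db hb Jb]] := kos_split_off_var dz' Jw hz'.
have [||||c [dc _ hc Jc]] := Vc b => //; first exact: kallT.
  apply/kall_colon; rewrite -kdZ.
  have -> : kd ('X_t *: b) = kd z - kd (z - kd w - 'X_t *: b).
    by rewrite !kdB kd_kd subr0 subKr.
  by apply: additive_predB (mono_additive J) Jz _; apply: kall_d_sub.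
exists (w + 'X_t *: c); split.
- have [_ kD kZ] := kdeg_submodule (rowmod 1) (kX ts) p.+1.
  by apply: kD => //; apply: kZ.
- exact: kallT.
- have [_ hD _] := @kall_additive _ (rowmod 1) _ (kX ts) (hom_additive deg0 p.+1 j.+1).
  by apply: hD => //; apply: kall_hom_dX.
- have -> : z - kd (w + 'X_t *: c) = (z - kd w - 'X_t *: b) + 'X_t *: (b - kd c).
    by rewrite kdD kdZ scalerBr addrA subrK opprD addrA.
  by apply: JD => //; apply/kall_colon.
Qed.

(** When x_t is a nonzerodivisor on S/J, the same exact sequence reads
    0 -> S/J(-1) -> S/J -> S/(J, x_t) -> 0, and it gives S/(J, x_t) from S/J. *)
Lemma vanish_add_var J t p j : up_closed J -> (forall mo, J (mo + U_(t))%MM -> J mo) ->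
  mono_vanish J p j.+1 -> (forall p', p = p'.+1 -> mono_vanish J p' j) ->
  mono_vanish (add_var_pred J t) p j.+1.
Proof.
move=> upJ regJ V V' z dz _ hz Jz; have [_ JD JN] := mono_additive J.
have sJ := mono_submodule upJ.
have upJx := add_var_up (t := t) upJ.
have [_ JxD JxN] := mono_additive (add_var_pred J t).
have [_ _ JxZ] := mono_submodule upJx.
have JJx (y : kos (kX ts) (rowmod 1)) : kall (row_pred (mono_ideal J)) y ->
    kall (row_pred (mono_ideal (add_var_pred J t))) y.
  by apply: kall_impl => u; rewrite !mono_ideal_row => Ju k mo /Ju; rewrite /add_var_pred => ->.
have XJx (y : kos (kX ts) (rowmod 1)) :
    kall (row_pred (mono_ideal (add_var_pred J t))) ('X_t *: y).
  apply: (kallZ (P := fun=> True)); last exact: kallT.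
  move=> u _; rewrite mono_ideal_row => k mo; rewrite mxE => /msuppMX_ex [m1 _ ->].
  by rewrite /add_var_pred mnmDE mnm1E eqxx addn1 orbT.
(* Subtracting x_t c turns a cycle modulo (J, x_t) into a cycle modulo J. *)
have [c [dc hc Jc]] : exists c : kos (kX ts) (rowmod 1), [/\ kdeg p c,
    kall (homog_row deg0 p j) c & kall (row_pred (mono_ideal J)) (kd (z - 'X_t *: c))].
  case: p dz hz V V' => [|p] dz hz V V'.
    exists 0; split; [exact: kdeg0|apply: kall0; exact: rsupp0|].
    rewrite scaler0 subr0 (kd_kdeg0 dz); apply: kall0.
    by rewrite mono_ideal_row; exact: rsupp0.
  have [b [db hb Jb]] := kos_split_off_var (kdeg_d dz) Jz (kall_hom_d hz).
  have [||||c [dc _ hc Jc]] := V' p erefl b => //; first exact: kallT.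
    have : kall (row_pred (mono_ideal J)) (kd ('X_t *: b)).
      have -> : 'X_t *: b = kd z - (kd z - 'X_t *: b) by rewrite subKr.
      rewrite kdB kd_kd sub0r; apply: JN; exact: kall_d_sub.
    rewrite kdZ => /kall_colon; apply: kall_impl => u.
    by rewrite !mono_ideal_row => Ju k mo /Ju /regJ.
  exists c; split=> //.
  have -> : kd (z - 'X_t *: c) = (kd z - 'X_t *: b) + 'X_t *: (b - kd c).
    by rewrite kdB kdZ scalerBr addrA subrK.
  apply: JD => //; apply: kallZ Jc => u; case: sJ => _ _; apply.
have [||||w [dw _ hw Jw]] := V (z - 'X_t *: c) => //.
- have [_ _ kZ] := kdeg_submodule (rowmod 1) (kX ts) p.
  by apply: submodule_predB (kdeg_submodule _ _ _) dz _; apply: kZ.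
- exact: kallT.
- apply: additive_predB (kall_additive _ (hom_additive _ _ _)) hz _.
  exact: kall_hom_dX.
exists w; split=> //; first exact: kallT.
have -> : z - kd w = (z - 'X_t *: c - kd w) + 'X_t *: c.
  by rewrite addrAC subrK.
by apply: JxD; [exact: JJx|exact: XJx].
Qed.

Lemma vanish_pred0 p j : (p < j)%N -> mono_vanish pred0 p j.
Proof.
move=> pj z dz _ hz Jz.
have e : kd z = 0.
  apply/kall_eq0; apply: kall_impl Jz => u /mono_ideal_row.
  exact: rsupp_none.
suff [w [dw hw ew]] : exists w, [/\ kdeg p.+1 w, kall (homog_row deg0 p.+1 j) w & z = kd w].
  exists w; split=> //; first exact: kallT.
  by rewrite ew subrr; apply: kall0; rewrite mono_ideal_row; exact: rsupp0.
case: p pj dz hz => [|p] pj dz hz; last exact: kos_exact.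
apply: hits_kcoef0_d => //; last exact: kall_coef0 hz.
move=> k mo /(kall_coef0 hz); rewrite /has_degree => /eqP ej; apply/hasP.
have [|t t0] := @mnm_neq0 _ mo; last by exists t.
by apply/eqP=> mo0; move: pj; rewrite -ej mo0 mdeg0.
Qed.

(** This is reg(S/I) <= r for the monomial ideal I of J. *)
Definition mono_bounded (J : pred mon) r := forall p j, (p + r < j)%N -> mono_vanish J p j.

Lemma bounded_colon J t r : up_closed J ->
  mono_bounded (colon_pred J t) r -> mono_bounded (add_var_pred J t) r.+1 ->
  mono_bounded J r.+1.
Proof.
move=> upJ Bc Bx p [//|j] pj; apply: (vanish_colon (t := t)) => //.
  by apply: Bc; move: pj; rewrite addnS.
exact: Bx.
Qed.

Lemma bounded_add_var J t r : up_closed J -> (forall mo, J (mo + U_(t))%MM -> J mo) ->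
  mono_bounded J r -> mono_bounded (add_var_pred J t) r.
Proof.
move=> upJ regJ BJ p [//|j] pj; apply: vanish_add_var => //; first exact: BJ.
by move=> p' ep; apply: BJ; move: pj; rewrite ep addSn.
Qed.

Lemma bounded_le J r r' : (r <= r')%N -> mono_bounded J r -> mono_bounded J r'.
Proof. by move=> rr BJ p j pj; apply: BJ; apply: leq_ltn_trans pj; rewrite leq_add2l. Qed.

Lemma bounded_eq J J' r : J =1 J' -> mono_bounded J r -> mono_bounded J' r.
Proof. by move=> e BJ p j pj; apply: mono_vanish_eq e _; apply: BJ. Qed.

Lemma bounded_vars s : uniq s -> mono_bounded (fun mo => has (fun t => (0 < mo t)%N) s) 0.
Proof.
elim: s => [_ p j|t s IH /= /andP [tns us]].
  by rewrite addn0 => pj; apply: mono_vanish_eq (vanish_pred0 pj).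
apply: (@bounded_eq (add_var_pred (fun mo => has (fun t => (0 < mo t)%N) s) t)).
  by move=> mo; rewrite /add_var_pred orbC.
apply: bounded_add_var; last exact: IH.
  move=> m1 m2 /hasP [i si i0]; apply/hasP; exists i => //.
  by rewrite mnmDE addn_gt0 i0.
move=> mo /hasP [i si]; rewrite mnmDE mnm1E => i0; apply/hasP; exists i => //.
by move: i0; case: eqP => [ti|_]; [rewrite ti si in tns|rewrite addn0].
Qed.

End MonomialIdeals.

(** * The Koszul cycle of an induced matching *)

Section Matching.
Variables (K : fieldType) (n : nat).
Local Notation S := {mpoly K[n]}.
Local Notation mon := 'X_{1..n}.
Local Notation kX ts := [seq ('X_t : S) | t <- ts].
Local Notation rowmod m := (matrix_matrix__canonical__GRing_Lmodule _ 1 m).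
Variables (J : pred mon) (upJ : up_closed J) (rest : seq 'I_n).

(** The variables are ordered so that the edges of the matching come first: then
    the four components of a chain with respect to the first edge (a, b) are the
    coefficients of 1, e_b, e_a and e_a e_b. *)
Fixpoint matching_vars (M : seq ('I_n * 'I_n)) : seq 'I_n :=
  if M is ab :: M' then ab.1 :: ab.2 :: matching_vars M' else rest.

(** Choosing one end of each edge of M and multiplying mo by the chosen variables
    always gives a monomial outside the ideal and free of the variables in rest. *)
Fixpoint transversals_out (M : seq ('I_n * 'I_n)) (mo : mon) : Prop :=
  if M is ab :: M'
  then transversals_out M' (mo + U_(ab.2))%MM /\ transversals_out M' (mo + U_(ab.1))%MM
  else ~~ J mo /\ forall t, t \in rest -> mo t = 0%N.

(** The sum, over the transversals T of the matching, of the coefficient of mo x_T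
    at the exterior product of the matched vertices not in T. This is evaluation of a
    simplicial cochain at the fundamental cycle of a cross-polytope, which is the
    independence complex of a disjoint union of edges. *)
Fixpoint matching_form M (mo : mon) : kos (kX (matching_vars M)) (rowmod 1) -> K :=
  if M is ab :: M' return kos (kX (matching_vars M)) (rowmod 1) -> K
  then fun z => matching_form (M := M') (mo + U_(ab.2))%MM z.2.1
              + matching_form (M := M') (mo + U_(ab.1))%MM z.1.2
  else fun z => (kcoef0 z 0 0)@_mo.

(** The product of the x_b e_a over the edges (a, b); the differential multiplies
    one of the factors x_b e_a into x_a x_b. *)
Fixpoint matching_cycle M : kos (kX (matching_vars M)) (rowmod 1) :=
  if M is ab :: M' return kos (kX (matching_vars M)) (rowmod 1)
  then ((0, 0), ('X_(ab.2) *: matching_cycle M', 0))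
  else kconst _ (1%:M : 'rV[S]_1).

Lemma matching_formB M mo z w :
  @matching_form M mo (z - w) = matching_form mo z - matching_form mo w.
Proof.
elim: M mo z w => [|ab M IH] mo /= z w; last first.
  by rewrite !IH opprD addrACA.
by rewrite linearB /= mxE [X in _ + X]mxE mcoeffB.
Qed.

Lemma matching_form0 M mo : @matching_form M mo 0 = 0.
Proof. by rewrite -[0 in LHS](subrr 0) matching_formB subrr. Qed.

Lemma matching_formN M mo z : @matching_form M mo (- z) = - matching_form mo z.
Proof. by rewrite -[- z]sub0r matching_formB matching_form0 sub0r. Qed.

Lemma matching_formD M mo z w :
  @matching_form M mo (z + w) = matching_form mo z + matching_form mo w.
Proof. by rewrite -[w in LHS]opprK matching_formB matching_formN opprK. Qed.

Lemma matching_formX M mo t z :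
  @matching_form M (mo + U_(t))%MM ('X_t *: z) = matching_form mo z.
Proof.
elim: M mo z => [|ab M IH] mo /= z; last first.
  have addAC s : (mo + U_(t) + U_(s) = mo + U_(s) + U_(t))%MM.
    by rewrite -!addmA (addmC U_(t)%MM).
  by rewrite !addAC !IH.
by rewrite linearZ /= mxE mulrC addmC mcoeffMX.
Qed.

(** In a boundary, the coefficients at e_a and e_b both involve the coefficient w of
    e_a e_b, multiplied by x_b and by x_a with opposite signs. The form reads them
    after removal of these factors, so they cancel. *)
Lemma matching_form_d M mo w :
  transversals_out M mo -> @matching_form M mo (kd w) = 0.
Proof.
elim: M mo w => [|ab M IH] mo /= w.
  case=> _ mo0; apply: memN_msupp_eq0; apply/negP.
  by move=> /kcoef0_d_hits /hasP [t /mo0 ->].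
case=> tb ta.
rewrite matching_formN !matching_formD !matching_formN !matching_formX.
by rewrite !IH // oppr0 add0r addNr.
Qed.

Lemma matching_form_out M mo z : transversals_out M mo ->
  kall (row_pred (mono_ideal J)) z -> @matching_form M mo z = 0.
Proof.
elim: M mo z => [|ab M IH] mo /= z.
  case=> /negP nJ _ /kall_coef0 Jz; apply: memN_msupp_eq0; apply/negP.
  by move/Jz.
by case: z => [[z1 z2] [z3 z4]] /= [tb ta] [[? ?] [? ?]]; rewrite !IH // addr0.
Qed.

Lemma matching_form_cycle M mo : matching_form mo (matching_cycle M) = (mo == 0%MM)%:R.
Proof.
elim: M => [|ab M IH] /=; first by rewrite kconstK mxE mcoeff1.
by rewrite matching_form0 addr0 matching_formX IH.
Qed.

Lemma matching_cycle_deg M : kdeg (size M) (matching_cycle M).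
Proof.
elim: M => [|ab M IH] /=; first exact: kdeg_const.
split; first by split; exact: kdeg0.
split; last by case: (size M) => // q; exact: kdeg0.
by have [_ _] := kdeg_submodule (rowmod 1) (kX (matching_vars M)) (size M); apply.
Qed.

Lemma matching_cycle_hom M a : kall (homog_row deg0 a (a + size M)) (matching_cycle M).
Proof.
have h0 (ts : seq 'I_n) j : kall (homog_row deg0 a j) (0 : kos (kX ts) (rowmod 1)).
  by apply: kall0; exact: rsupp0.
elim: M => [|ab M IH] /=.
  apply: kall_const; first exact: rsupp0.
  move=> k mo; rewrite !ord1 mxE msupp1 inE => /eqP ->.
  by rewrite /has_degree mdeg0 addn0.
do 2![split=> //].
apply: kallZ IH => u hu; apply: homX.
by apply: rsupp_impl hu => k mo; rewrite /has_degree !addnS eqSS.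
Qed.

Lemma matching_cycle_d M :
    (forall ab, ab \in M -> J (U_(ab.1) + U_(ab.2))%MM) ->
  kall (row_pred (mono_ideal J)) (kd (matching_cycle M)).
Proof.
have sJ := mono_submodule K upJ; have [J0 _ JZ] := sJ.
have z0 (ts : seq 'I_n) : kall (row_pred (mono_ideal J)) (0 : kos (kX ts) (rowmod 1)).
  exact: kall0.
elim: M => [|ab M IH] /= edge; first by rewrite kd_const.
have {}IH : kall (row_pred (mono_ideal J)) (kd (matching_cycle M)).
  by apply: IH => cd cdM; apply: edge; rewrite inE cdM orbT.
rewrite kd0 !scaler0 !addr0 oppr0 add0r; split; split=> //.
  rewrite scalerA; apply: (kallZ (P := fun=> True)); last exact: kallT.
  move=> u _; rewrite mono_ideal_row => k mo; rewrite mxE -mpolyXD.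
  move=> /msuppM_ex [m1 [m2 [/mem_msuppXP <- _ ->]]].
  by apply/upJ/edge; rewrite mem_head.
  rewrite kdZ -scaleN1r; apply: (kallZ (P := row_pred (mono_ideal J))) => [u|]; first exact: JZ.
  by apply: kallZ IH => u; apply: JZ.
by rewrite oppr0.
Qed.

Lemma matching_nonvanish M :
    (forall ab, ab \in M -> J (U_(ab.1) + U_(ab.2))%MM) ->
    transversals_out M 0%MM ->
  ~ mono_vanish K (matching_vars M) J (size M) (size M + size M).
Proof.
move=> edge out V.
have [||||w [_ _ _ Jw]] := V (matching_cycle M).
- exact: matching_cycle_deg.
- exact: kallT.
- exact: matching_cycle_hom.
- exact: matching_cycle_d.
have := matching_form_out out Jw.
rewrite matching_formB matching_form_d // matching_form_cycle eqxx subr0.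
by apply/eqP/oner_neq0.
Qed.

End Matching.

(** * Shedding vertices and induced matchings *)

Section Graphs.
Variables (V : finType) (e : rel V).
Hypotheses (e_sym : ssrbool.symmetric e) (e_irr : irreflexive e).
Implicit Types (W A F : {set V}) (M : {set {set V}}).

Definition nbrs W x : {set V} := [set y in W | e x y].
Definition cl_nbrs W x : {set V} := x |: nbrs W x.
Definition indep A : bool := [forall x in A, forall y in A, ~~ e x y].
(** The independence complex of the subgraph induced on W. Subsets of the vertex set
    stand for induced subgraphs, so that deletions and links stay in one type. *)
Definition ind_complex W : {set {set V}} := [set A : {set V} | (A \subset W) && indep A].

Lemma indepP A : reflect {in A &, forall x y, ~~ e x y} (indep A).
Proof.
apply: (iffP forall_inP) => [h x y xA yA|h x xA]; first by have /forall_inP := h x xA; apply.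
by apply/forall_inP=> y; apply: h.
Qed.

Lemma indepS A A' : A \subset A' -> indep A' -> indep A.
Proof. by move=> /subsetP s /indepP h; apply/indepP=> x y /s ? /s ?; apply: h. Qed.

Lemma indepU1 A x : {in A, forall y, ~~ e x y} -> indep A -> indep (x |: A).
Proof.
move=> hx /indepP hA; apply/indepP=> a b /setU1P [->|aA] /setU1P [->|bA].
- by rewrite e_irr.
- exact: hx.
- by rewrite e_sym; apply: hx.
- exact: hA.
Qed.

Lemma edge_neq x y : e x y -> x != y.
Proof. by apply: contraTneq => ->; rewrite e_irr. Qed.

Lemma has_induced_cycle4 a b c d : e a b -> e b c -> e c d -> e d a ->
  ~~ e a c -> ~~ e b d -> a != c -> b != d -> has_induced_cycle e 4.
Proof.
move=> ab bc cd da ac bd nac nbd.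
have U : uniq [:: a; b; c; d].
  rewrite /= !inE !negb_or nac nbd (edge_neq ab) (edge_neq bc) (edge_neq cd).
  by rewrite (eq_sym a d) (edge_neq da).
exists (fun i : 'I_4 => nth a [:: a; b; c; d] i); split=> [i j /eqP|].
  by rewrite nth_uniq // => /eqP ij; apply: val_inj.
have red := (e_irr, ab, bc, cd, da, negPf ac, negPf bd).
by do 2![case=> [[|[|[|[|?]]]] ?] //]; rewrite -!val_eqE /= ?red // e_sym ?red.
Qed.

Lemma has_induced_cycle5 a b c d f : e a b -> e b c -> e c d -> e d f -> e f a ->
  ~~ e a c -> ~~ e a d -> ~~ e b d -> ~~ e b f -> ~~ e c f ->
  a != c -> a != d -> b != d -> b != f -> c != f -> has_induced_cycle e 5.
Proof.
move=> ab bc cd df fa ac ad bd bf cf nac nad nbd nbf ncf.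
have U : uniq [:: a; b; c; d; f].
  rewrite /= !inE !negb_or nac nad nbd nbf ncf (edge_neq ab) (edge_neq bc).
  by rewrite (edge_neq cd) (edge_neq df) (eq_sym a f) (edge_neq fa).
exists (fun i : 'I_5 => nth a [:: a; b; c; d; f] i); split=> [i j /eqP|].
  by rewrite nth_uniq // => /eqP ij; apply: val_inj.
have red := (e_irr, ab, bc, cd, df, fa, negPf ac, negPf ad, (negPf bd, negPf bf, negPf cf)).
by do 2![case=> [[|[|[|[|[|?]]]]] ?] //]; rewrite -!val_eqE /= ?red // e_sym ?red.
Qed.

Hypothesis e_free : C4_C5_free e.

(** Otherwise y, z, a, y' is an induced 4-cycle if y and y' are adjacent, and
    x, y, z, a, y' is an induced 5-cycle if they are not. *)
Lemma C4_C5_free_exchange W x y z a y' : y \in nbrs W x -> y' \in nbrs W x ->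
  e y z -> z != x -> ~~ e x z -> a != x -> ~~ e x a -> e z a -> ~~ e y a -> e y' a ->
  e y' z.
Proof.
rewrite !inE => /andP [_ xy] /andP [_ xy'] yz zx xz ax xa za ya y'a.
apply/negPn/negP => y'z; case: e_free => no4 no5.
have ny : y != a by apply: contraNneq xa => <-.
have nz : z != y' by apply: contraNneq xz => ->.
have nyy' : y != y' by apply: contraNneq ya => ->.
have ay' : e a y' by rewrite e_sym.
have zy' : ~~ e z y' by rewrite e_sym.
have [yy'|yy'] := boolP (e y y').
  by apply: no4; apply: (has_induced_cycle4 (a := y) (b := z) (c := a) (d := y')); rewrite // e_sym.
apply: no5; apply: (has_induced_cycle5 (a := x) (b := y) (c := z) (d := a) (f := y')) => //.
- by rewrite e_sym.
- by rewrite eq_sym.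
- by rewrite eq_sym.
Qed.

(** Suppose that every neighbour of x has a neighbour outside N[x]. Take an
    independent set A outside N[x] that dominates as many neighbours of x as
    possible. If y in N(x) is undominated, with neighbour z outside N[x], then
    replacing the neighbours of z in A by z keeps everything that was dominated,
    by [C4_C5_free_exchange], and adds y. Hence A dominates N(x), and a facet of
    the deletion of x that contains A can be enlarged by x: x is not shedding. *)
Lemma shedding_dominated W x : x \in W ->
  (forall F, is_facet (deletion (ind_complex W) x) F -> is_facet (ind_complex W) F) ->
  exists2 y, y \in nbrs W x & {in W, forall z, e y z -> z != x -> e x z}.
Proof.
move=> xW shed; apply: NNPP => no.
have far y : y \in nbrs W x -> exists z, [/\ z \in W, e y z, z != x & ~~ e x z].
  move=> yN; apply: NNPP => noz; apply: no; exists y => // z zW yz zx.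
  by apply/negPn/negP => xz; apply: noz; exists z.
pose C := [pred A : {set V} | (A \subset W :\: cl_nbrs W x) && indep A].
pose dom A := [set y in nbrs W x | [exists a in A, e y a]].
have C0 : C set0 by rewrite /= sub0set; apply/indepP=> a b; rewrite inE.
case: (arg_maxnP (fun A => #|dom A|) C0) => A /andP [/subsetP AW iA] maxA.
have outA a : a \in A -> [/\ a \in W, a != x & ~~ e x a].
  by move=> /AW; rewrite !inE negb_or -andbA => /and3P [ax]; case: (a \in W).
have domA y : y \in nbrs W x -> exists2 a, a \in A & e y a.
  move=> yN; apply/exists_inP; apply: contraT => ndom.
  have [z [zW yz zx xz]] := far y yN.
  pose A' := z |: [set a in A | ~~ e z a].
  have CA' : C A'.
    apply/andP; split.
      apply/subsetP=> a /setU1P [->|]; last by rewrite inE => /andP [/AW].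
      by rewrite !inE negb_or zx zW xz.
    apply: indepU1 => [a|]; first by rewrite inE => /andP [].
    by apply: indepS iA; apply/subsetP=> a; rewrite inE => /andP [].
  suff lt : (#|dom A| < #|dom A'|)%N.
    by have := maxA A' CA'; rewrite /geq /= leqNgt lt.
  apply: proper_card; apply/properP; split; last first.
    exists y; last by rewrite inE negb_and ndom orbT.
    by rewrite inE yN; apply/exists_inP; exists z; rewrite // setU11.
  apply/subsetP=> y'; rewrite !(inE, in_set) => /andP [y'N /exists_inP [a aA y'a]].
  rewrite y'N; apply/exists_inP.
  have [za|za] := boolP (e z a); last by exists a => //; rewrite !inE aA za orbT.
  exists z; first exact: setU11.
  have [aW ax xa] := outA a aA.
  apply: (@C4_C5_free_exchange W x y z a y') => //; first by rewrite inE.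
  by apply: contra ndom => ya; apply/exists_inP; exists a.
have AD : A \in deletion (ind_complex W) x.
  rewrite !inE iA andbT; apply/andP; split.
    by apply/subsetP=> a /outA [].
  by apply/negP=> /outA []; rewrite eqxx.
have [F maxF AF] := maxset_exists AD.
have FD : F \in deletion (ind_complex W) x by case/maxsetP: maxF.
have /shed /maxsetP [FW' maxF'] := maxF.
have FW : F \in ind_complex W by [].
have xF : x \notin F by move: FD; rewrite inE => /andP [].
have /andP [sFW iF] : (F \subset W) && indep F by move: FW; rewrite inE.
have eF : x |: F = F.
  apply: maxF'; last exact: subsetUr.
  rewrite inE subUset sub1set xW sFW; apply: indepU1 => // y yF.
  apply/negP=> xy; have [|a aA ya] := domA y; first by rewrite inE (subsetP sFW).
  by have /indepP := iF => /(_ y a yF (subsetP AF _ aA)); rewrite ya.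
by move: xF; rewrite -eF setU11.
Qed.

Lemma deletion_ind W x : deletion (ind_complex W) x = ind_complex (W :\ x).
Proof.
apply/setP=> A; rewrite !inE subsetD1.
by case: (A \subset W); case: (indep A); rewrite ?andbT ?andbF.
Qed.

Lemma link_ind W x : x \in W -> link (ind_complex W) x = ind_complex (W :\: cl_nbrs W x).
Proof.
move=> xW; apply/setP=> A; rewrite !inE; apply/idP/idP.
  case/andP=> /andP [AW iA] /and3P [xA xAW /indepP ixA].
  rewrite iA andbT; apply/subsetP=> a aA; rewrite !inE negb_or (subsetP AW) //=.
  rewrite andbT; apply/andP; split; first by apply: contraNneq xA => <-.
  by apply: ixA; rewrite ?setU11 // setU1r.
case/andP=> /subsetP AW iA; rewrite iA !andbT subUset sub1set xW.
have AW' : A \subset W by apply/subsetP=> a /AW; rewrite inE => /andP [].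
rewrite AW' /=; apply/andP; split.
  by apply/negP=> /AW; rewrite !inE eqxx.
apply: indepU1 => // a aA; have := AW a aA; rewrite !inE (subsetP AW') //=.
by rewrite andbT negb_or => /andP [].
Qed.

(** All that the bounds on the regularity and on the v-number need to know about a
    graph: it can be dismantled to edgeless graphs by removing a vertex x or its
    closed neighbourhood, and r bounds how often the second happens. *)
Inductive shedding_depth : {set V} -> nat -> Prop :=
| shedding_edgeless W r of {in W &, forall x y, ~~ e x y} : shedding_depth W r
| shedding_vertex W x r of x \in W & shedding_depth (W :\ x) r.+1
    & shedding_depth (W :\: cl_nbrs W x) r : shedding_depth W r.+1.

Lemma shedding_depth_leq W r r' : (r <= r')%N -> shedding_depth W r -> shedding_depth W r'.
Proof.
move=> rr' h; elim: h r' rr' => {W r} [W r noe r' _|W x r xW _ IH1 _ IH2 [//|r'] rr'].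
  exact: shedding_edgeless.
by apply: (shedding_vertex xW); [exact: IH1|exact: IH2].
Qed.

Definition matching_number W : nat :=
  \max_(M : {set {set V}} | induced_matching e M && (cover M \subset W)) #|M|.

Lemma matching_number_sub W W' : W \subset W' -> (matching_number W <= matching_number W')%N.
Proof.
move=> WW'; apply/bigmax_leqP=> M /andP [iM cM].
by apply: leq_bigmax_cond; rewrite iM (subset_trans cM).
Qed.

Lemma is_edgeP A : reflect (exists x y, e x y /\ A = [set x; y]) (is_edge e A).
Proof.
apply: (iffP existsP) => [[x /existsP [y /andP [xy /eqP ->]]]|[x [y [xy ->]]]].
  by exists x, y.
by exists x; apply/existsP; exists y; rewrite xy eqxx.
Qed.

Lemma induced_matching0 : induced_matching e set0.
Proof.
apply/and3P; split.
- by apply/forall_inP=> A; rewrite inE.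
- by apply/trivIsetP=> A B; rewrite inE.
- apply/forallP=> A; apply/implyP=> /andP [/is_edgeP [a [b [_ ->]]] /subsetP /(_ a)].
  by rewrite /cover big_set0 !inE eqxx => /(_ isT).
Qed.

(** Since N[y] is contained in N[x], the edge xy is not joined to anything outside
    N[x]. *)
Lemma induced_matching_add W x y M : x \in W -> y \in nbrs W x ->
    {in W, forall z, e y z -> z != x -> e x z} ->
    induced_matching e M -> cover M \subset W :\: cl_nbrs W x ->
  induced_matching e ([set x; y] |: M) /\ [set x; y] \notin M.
Proof.
move=> xW yN dom /and3P [/forall_inP eM tM /forallP cM] cMW.
have [yW xy] : y \in W /\ e x y by move: yN; rewrite inE => /andP.
have outM z : z \in cover M -> [/\ z != x, z \in W & ~~ e x z].
  by move=> /(subsetP cMW); rewrite !inE negb_or => /andP [/andP [? xz] zW]; move: xz; rewrite zW.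
have outM' z : z \in cover M -> ~~ e y z.
  by move=> /outM [zx zW xz]; apply: contra xz => yz; apply: dom.
have n0 : set0 \notin M.
  by apply/negP=> /eM /is_edgeP [a [b [_ /setP /(_ a)]]]; rewrite !inE eqxx.
have dis : {in M, forall B : {set V}, [disjoint [set x; y] & B]}.
  move=> B BM; rewrite disjoints_subset; apply/subsetP=> z; rewrite !inE => zxy.
  apply/negP=> zB; have /outM [zx zW xz] : z \in cover M by apply/bigcupP; exists B.
  by case/orP: zxy => /eqP ez; [rewrite ez eqxx in zx|rewrite ez xy in xz].
have [tM' nM] := trivIsetU1 dis tM n0.
split=> //; apply/and3P; split=> //.
  apply/forall_inP=> A /setU1P [->|]; last exact: eM.
  by apply/is_edgeP; exists x, y.
apply/forallP=> A; apply/implyP=> /andP [/is_edgeP [a [b [ab ->]]]].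
have cU : cover ([set x; y] |: M) = [set x; y] :|: cover M.
  by rewrite /cover bigcup_setU big_set1.
rewrite cU => /subsetP sub.
have ina : a \in [set x; y] :|: cover M by apply: sub; rewrite !inE eqxx.
have inb : b \in [set x; y] :|: cover M by apply: sub; rewrite !inE eqxx orbT.
have no c d : c \in [set x; y] -> d \in cover M -> e c d -> False.
  rewrite !inE => /orP [/eqP ->|/eqP ->] dM cd.
    by have [_ _ /negP] := outM d dM; apply.
  by have /negP := outM' d dM; apply.
case/setUP: ina => ina; case/setUP: inb => inb.
- apply/setU1P; left; move: ina inb ab; rewrite !inE.
  case/orP=> /eqP -> /orP [] /eqP ->; rewrite ?e_irr // => _.
  by rewrite setUC.
- by case: (no a b).
- by case: (no b a) => //; rewrite e_sym.
- apply/setU1P; right; have /implyP := cM [set a; b]; apply.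
  apply/andP; split; first by apply/is_edgeP; exists a, b.
  by apply/subsetP=> z /set2P [->|->].
Qed.

Lemma matching_number_step W x y : x \in W -> y \in nbrs W x ->
    {in W, forall z, e y z -> z != x -> e x z} ->
  (matching_number (W :\: cl_nbrs W x) < matching_number W)%N.
Proof.
move=> xW yN dom; have [yW xy] : y \in W /\ e x y by move: yN; rewrite inE => /andP.
have lt M : induced_matching e M && (cover M \subset W :\: cl_nbrs W x) ->
    (#|M| < matching_number W)%N.
  case/andP=> iM cM; have [iM' nM] := induced_matching_add xW yN dom iM cM.
  have -> : #|M|.+1 = #|[set x; y] |: M| by rewrite cardsU1 nM.
  apply: leq_bigmax_cond; rewrite iM' /=.
  rewrite /cover bigcup_setU big_set1 subUset; apply/andP; split.
    by apply/subsetP=> z /set2P [->|->].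
  by apply: subset_trans cM _; apply: subsetDl.
have pos : (0 < matching_number W)%N.
  apply: leq_ltn_trans (lt set0 _); first by [].
  by rewrite induced_matching0 /cover big_set0 sub0set.
rewrite -(prednK pos) ltnS; apply/bigmax_leqP=> M /lt.
by rewrite -{1}(prednK pos).
Qed.

(** Deleting a shedding vertex does not increase the matching number, and removing
    its closed neighbourhood decreases it, by [matching_number_step]. *)
Lemma vd_shedding_depth D : vertex_decomposable_complex D ->
  forall W, D = ind_complex W -> shedding_depth W (matching_number W).
Proof.
elim=> {D} [|F|D x xD _ IHd _ IHl shed] W eD.
- by have := in_set0 (set0 : {set V}); rewrite eD !inE sub0set => /negP []; apply/indepP=> a b; rewrite inE.
- have WF : W \subset F.
    apply/subsetP=> x xW; have : [set x] \in ind_complex W.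
      by rewrite inE sub1set xW; apply/indepP=> a b /set1P -> /set1P ->; rewrite e_irr.
    by rewrite -eD inE sub1set.
  apply: shedding_edgeless; apply/indepP.
  by have : W \in powerset F; [rewrite inE|rewrite eD inE => /andP []].
have xW : x \in W by move: xD; rewrite eD inE sub1set => /andP [].
rewrite {}eD in IHd IHl shed.
have [y yN dom] := shedding_dominated xW shed.
have lt := matching_number_step xW yN dom.
have {lt} [r er lt] : exists2 r, matching_number W = r.+1 & (matching_number (W :\: cl_nbrs W x) <= r)%N.
  by case: (matching_number W) lt => // r; exists r.
rewrite er; apply: (shedding_vertex xW).
  apply: shedding_depth_leq (IHd _ (deletion_ind W x)).
  by rewrite -er; apply/matching_number_sub/subD1set.
exact: shedding_depth_leq lt (IHl _ (link_ind xW)).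
Qed.

Lemma matching_numberT : matching_number setT = induced_matching_number e.
Proof. by apply: eq_bigl => M; rewrite subsetT andbT. Qed.

Lemma ind_complexT : independence_complex e = ind_complex setT.
Proof. by apply/setP=> A; rewrite !inE subsetT. Qed.

(** The set A collects the vertices whose closed neighbourhoods are removed: an edge
    with no end in N(x) avoids N[x], and an edge through x has its other end
    in N(x). *)
Lemma shedding_cover W r : shedding_depth W r ->
  exists A : {set V}, [/\ A \subset W, indep A, (#|A| <= r)%N
    & {in W &, forall x y, e x y -> exists2 a, a \in A & e a x || e a y}].
Proof.
elim=> {W r} [W r noe|W x r xW _ _ _ [A [AW iA cA covA]]].
  exists set0; split; rewrite ?sub0set ?cards0 //.
    by apply/indepP=> a b; rewrite inE.
  by move=> x y xW yW; rewrite (negPf (noe x y xW yW)).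
have outA a : a \in A -> [/\ a != x, a \in W & ~~ e x a].
  by move=> /(subsetP AW); rewrite !inE negb_or => /andP [/andP [? xa] aW]; move: xa; rewrite aW.
exists (x |: A); split.
- by rewrite subUset sub1set xW; apply/subsetP=> a /outA [].
- by apply: indepU1 => // a /outA [].
- by rewrite cardsU1; apply: (leq_add (n1 := 1)) => //; case: (x \notin A).
- move=> a b aW bW ab.
  have [xa|xa] := boolP (e x a); first by exists x; rewrite ?setU11 ?xa.
  have [xb|xb] := boolP (e x b); first by exists x; rewrite ?setU11 ?xb ?orbT.
  have [||c cA' cab] := covA a b _ _ ab.
  + rewrite !inE aW (negPf xa) !andbT orbF.
    by apply: contraNneq xb => <-.
  + rewrite !inE bW (negPf xb) !andbT orbF.
    by apply: contraNneq xa => <-; rewrite e_sym.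
  by exists c; rewrite // setU1r.
Qed.

End Graphs.

(** * Edge ideals *)

Section EdgeIdeals.
Variables (K : fieldType) (V : finType) (e : rel V).
Hypotheses (e_sym : ssrbool.symmetric e) (e_irr : irreflexive e).
Local Notation n := #|V|.
Local Notation S := {mpoly K[n]}.
Local Notation mon := 'X_{1..n}.
Implicit Types (W U : {set V}).

Definition divides_var (x : V) (mo : mon) : bool := (0 < mo (enum_rank x))%N.

(** The monomials of the ideal I(G[W]) + (U); adding the variables in U makes the
    family closed under colon by, and addition of, a variable of W. *)
Definition graph_mon W U (mo : mon) : bool :=
  [exists x in W, exists y in W, [&& e x y, divides_var x mo & divides_var y mo]]
  || [exists u in U, divides_var u mo].

Lemma divides_varD x m1 m2 : divides_var x (m1 + m2)%MM = divides_var x m1 || divides_var x m2.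
Proof. by rewrite /divides_var mnmDE addn_gt0. Qed.

Lemma divides_varU x y : divides_var x U_(enum_rank y)%MM = (x == y).
Proof. by rewrite /divides_var mnm1E (inj_eq enum_rank_inj) eq_sym; case: (x == y). Qed.

Lemma graph_monP W U mo : reflect
  ((exists x y, [/\ x \in W, y \in W, e x y, divides_var x mo & divides_var y mo])
    \/ exists2 u, u \in U & divides_var u mo) (graph_mon W U mo).
Proof.
apply: (iffP orP) => [[/exists_inP [x xW /exists_inP [y yW /and3P [? ? ?]]]|/exists_inP [u]]|].
- by left; exists x, y.
- by right; exists u.
case=> [[x [y [xW yW ? ? ?]]]|[u uU du]]; [left|right]; last by apply/exists_inP; exists u.
by apply/exists_inP; exists x => //; apply/exists_inP; exists y => //; apply/and3P.
Qed.

Lemma graph_mon_up W U : up_closed (graph_mon W U).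
Proof.
move=> m1 m2 /graph_monP h; apply/graph_monP; case: h => [[x [y [? ? ? dx dy]]]|[u ? du]].
  by left; exists x, y; split=> //; rewrite divides_varD ?dx ?dy.
by right; exists u => //; rewrite divides_varD du.
Qed.

Lemma graph_mon_colon W U x : x \in W -> x \notin U ->
  colon_pred (graph_mon W U) (enum_rank x)
    =1 graph_mon (W :\: cl_nbrs e W x) (U :|: nbrs e W x).
Proof.
move=> xW xU mo; apply/graph_monP/graph_monP; last first.
  case=> [[a [b []]]|[u]].
    rewrite !inE => /andP [_ aW] /andP [_ bW] ab da db.
    by left; exists a, b; rewrite !divides_varD da db.
  rewrite !inE => /orP [uU|/andP [uW xu]] du.
    by right; exists u; rewrite // divides_varD du.
  by left; exists x, u; rewrite !divides_varD !divides_varU eqxx du orbT.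
have near c : c \in W -> e x c -> divides_var c mo ->
    exists2 u, u \in U :|: nbrs e W x & divides_var u mo.
  by move=> cW xc dc; exists c; rewrite // !inE cW xc orbT.
case=> [[a [b [aW bW ab]]]|[u uU]]; rewrite !divides_varD !divides_varU; last first.
  case/orP=> [du|/eqP ux]; last by rewrite -ux uU in xU.
  by right; exists u; rewrite // inE uU.
have [xa da _|xa] := boolP (e x a).
  right; apply: (near a) => //; case/orP: da => // /eqP ax.
  by rewrite ax e_irr in xa.
have [xb _ db|xb] := boolP (e x b).
  right; apply: (near b) => //; case/orP: db => // /eqP bx.
  by rewrite bx e_irr in xb.
have ax : a != x by apply: contraNneq xb => <-.
have bx : b != x by apply: contraNneq xa => <-; rewrite e_sym.
rewrite (negPf ax) (negPf bx) !orbF => da db.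
by left; exists a, b; rewrite !inE (negPf ax) (negPf bx) aW bW (negPf xa) (negPf xb).
Qed.

Lemma graph_mon_add_var W U x : x \in W ->
  add_var_pred (graph_mon W U) (enum_rank x) =1
    add_var_pred (graph_mon (W :\ x) (x |: U)) (enum_rank x).
Proof.
move=> xW mo; apply/orP/orP; (case; last by right); move/graph_monP; last first.
  case=> [[a [b []]]|[u]].
    rewrite !inE => /andP [_ aW] /andP [_ bW] ab da db.
    by left; apply/graph_monP; left; exists a, b.
  by rewrite !inE => /orP [/eqP -> |uU] du; [right|left; apply/graph_monP; right; exists u].
case=> [[a [b [aW bW ab da db]]]|[u uU du]]; last first.
  by left; apply/graph_monP; right; exists u; rewrite // !inE uU orbT.
have [ax|ax] := eqVneq a x; first by right; rewrite -ax.
have [bx|bx] := eqVneq b x; first by right; rewrite -bx.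
by left; apply/graph_monP; left; exists a, b; rewrite !inE ax bx aW bW.
Qed.

Lemma graph_mon_setU1 W U x :
  add_var_pred (graph_mon W (x |: U)) (enum_rank x) =1 graph_mon W (x |: U).
Proof.
move=> mo; rewrite /add_var_pred orbC; case: ltnP => //= x0; apply/esym/graph_monP.
by right; exists x; rewrite ?setU11.
Qed.

Variables (ts : seq 'I_n) (uts : uniq ts) (fts : forall t, t \in ts).

(** Both (I : x) and (I, x) stay in the family, with W replaced by W - N[x] and
    W - x, so [bounded_colon] follows the dismantling of the graph. *)
Lemma graph_bounded W r : shedding_depth e W r ->
  forall U, [disjoint W & U] -> mono_bounded K ts (graph_mon W U) r.
Proof.
elim=> {W r} [W r noe|W x r xW _ IH1 _ IH2] U disU.
  apply: bounded_le (leq0n r) _.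
  apply: bounded_eq (bounded_vars uts fts (s := [seq enum_rank u | u <- enum U]) _); last first.
    by rewrite (map_inj_uniq enum_rank_inj) enum_uniq.
  move=> mo; rewrite has_map; apply/hasP/graph_monP.
    by case=> u; rewrite mem_enum => uU du; right; exists u.
  case=> [[a [b [aW bW ab]]]|[u uU du]]; first by rewrite (negPf (noe a b aW bW)) in ab.
  by exists u; rewrite ?mem_enum.
have xU : x \notin U by rewrite (disjointFr disU).
apply: (bounded_colon (t := enum_rank x)); first exact: graph_mon_up.
  apply: (bounded_eq (fun mo => esym (graph_mon_colon xW xU mo))); apply: IH2.
  rewrite disjoints_subset; apply/subsetP=> y; rewrite !inE negb_or.
  by case/andP=> /andP [_ /negPf ->] yW; rewrite orbF (disjointFr disU).
apply: bounded_eq (IH1 (x |: U) _) => [mo|].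
  by rewrite graph_mon_add_var // graph_mon_setU1.
rewrite disjoints_subset; apply/subsetP=> y; rewrite !inE negb_or.
by case/andP=> -> yW; rewrite (disjointFr disU).
Qed.

Local Notation J := (graph_mon setT set0).

Lemma ideal_gen_is_ideal (R : comNzRingType) (gens : R -> Prop) : is_ideal (ideal_gen gens).
Proof.
split.
- exists 0%N, (fun=> 0), (fun=> 0); split; first by case.
  by rewrite big_ord0.
- move=> a b [k [c [g [gg ->]]]] [k' [c' [g' [gg' ->]]]].
  exists (k + k')%N, (fun i => match split i with inl i => c i | inr i => c' i end),
    (fun i => match split i with inl i => g i | inr i => g' i end).
  split; first by move=> i; case: split => j.
  rewrite big_split_ord; congr (_ + _); apply: eq_bigr => i _.
    by rewrite (unsplitK (inl _ i)).
  by rewrite (unsplitK (inr _ i)).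
- move=> a b [k [c [g [gg ->]]]]; exists k, (fun i => a * c i), g; split=> //.
  by rewrite mulr_sumr; apply: eq_bigr => i _; rewrite mulrA.
Qed.

Lemma edge_ideal_mono f : edge_ideal K e f <-> mono_ideal J f.
Proof.
split.
  case=> k [a [g [gg ->]]].
  have [I0 ID IM] := mono_ideal_is_ideal K (@graph_mon_up setT set0).
  apply: big_ind => // i _; apply: IM; case: (gg i) => x [y [xy ->]] mo.
  rewrite -mpolyXD => /mem_msuppXP <-; apply/graph_monP; left; exists x, y.
  by rewrite !divides_varD !divides_varU !eqxx orbT !inE.
have [I0 ID IM] := ideal_gen_is_ideal
  (fun m : S => exists x y, e x y /\ m = 'X_(enum_rank x) * 'X_(enum_rank y)).
move=> Jf; rewrite [f]mpolyE big_seq; apply: big_ind => // mo /Jf /graph_monP.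
case=> [[x [y [_ _ xy dx dy]]]|[u]]; last by rewrite inE.
have -> : 'X_[mo] = 'X_[mo - (U_(enum_rank x) + U_(enum_rank y))]
    * ('X_(enum_rank x) * 'X_(enum_rank y)) :> S.
  rewrite -!mpolyXD submK //; apply/mnm_lepP=> t; rewrite mnmDE !mnm1E.
  move: dx dy; rewrite /divides_var.
  have nxy : enum_rank x != enum_rank y by rewrite (inj_eq enum_rank_inj) (edge_neq e_irr).
  have [<-|_] := eqVneq (enum_rank x) t; last first.
    by have [<-|_] := eqVneq (enum_rank y) t.
  by rewrite eq_sym (negPf nxy) addn0.
rewrite scalerAl; apply: IM; exists 1%N, (fun=> 1), (fun=> 'X_(enum_rank x) * 'X_(enum_rank y)).
split; first by move=> _; exists x, y.
by rewrite big_ord1 mul1r.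
Qed.

Lemma edge_ideal_is_ideal : is_ideal (edge_ideal K e).
Proof. exact: ideal_gen_is_ideal. Qed.

Lemma edge_ideal_row u : row_pred (edge_ideal K e) u <-> row_pred (mono_ideal J) u.
Proof. exact: edge_ideal_mono. Qed.

Lemma edge_ideal_gr a j u : row_pred (edge_ideal K e) u ->
  row_pred (edge_ideal K e) (rfilter (has_degree deg0 a j) u).
Proof. by rewrite !edge_ideal_row; apply: mono_ideal_gr. Qed.

Lemma edge_ideal_nonunit f : edge_ideal K e f -> f@_0%MM = 0.
Proof.
move=> /edge_ideal_mono Jf; apply: memN_msupp_eq0; apply/negP=> /Jf /graph_monP.
by case=> [[x [y [_ _ _]]]|[u]]; rewrite ?inE // /divides_var mnm0E.
Qed.

Lemma edge_ideal_vanish p j :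
  mono_vanish K ts J p j <-> quotient_vanish ts (edge_ideal K e) p j.
Proof.
by split; apply: koszul_vanish_eq => // u; rewrite edge_ideal_row.
Qed.

Lemma edge_ideal_bounded r : shedding_depth e setT r ->
  forall p j, (p + r < j)%N -> quotient_vanish ts (edge_ideal K e) p j.
Proof.
move=> sd p j pj; apply/edge_ideal_vanish; apply: (graph_bounded sd) => //.
by rewrite disjoints_subset setC0.
Qed.

(** For A as in [shedding_cover] and f the product of its variables, the ideal
    (I : f) is generated by the variables in N(A): these lie in it as A is joined
    to N(A), and N(A) meets every edge. An ideal generated by variables is prime. *)
Lemma v_degree_le_depth r : shedding_depth e setT r ->
  exists2 d, (d <= r)%N & v_degree (edge_ideal K e) d.
Proof.
move=> /(shedding_cover e_sym e_irr) [A [_ iA cA covA]].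
exists #|A| => //.
pose mA : mon := (\sum_(a in A) U_(enum_rank a))%MM.
have dA x : divides_var x mA = (x \in A).
  rewrite /divides_var mnm_sumE lt0n sum_nat_eq0 negb_forall_in.
  apply/exists_inP/idP => [[a aA]|xA].
    by rewrite mnm1E (inj_eq enum_rank_inj) eqb0 negbK => /eqP <-.
  by exists x; rewrite // mnm1E eqxx.
pose C (x : V) := [exists a in A, e a x].
pose P (h : S) := forall mo, mo \in msupp h -> exists2 x, C x & divides_var x mo.
have colP h : colon (edge_ideal K e) 'X_[mA] h <-> P h.
  rewrite /colon edge_ideal_mono; split=> [Jh mo moh|Ph mo].
    have /Jh/graph_monP : (mA + mo)%MM \in msupp (h * 'X_[mA]).
      by rewrite mcoeff_msupp mcoeffMX -mcoeff_msupp.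
    case=> [[x [y [_ _ xy]]]|[u]]; last by rewrite inE.
    rewrite !divides_varD !dA => dx dy.
    have [xA|xA] := boolP (x \in A).
      case/orP: dy => [yA|]; last by exists y => //; apply/exists_inP; exists x.
      by have /indepP/(_ x y xA yA) := iA; rewrite xy.
    have [yA|yA] := boolP (y \in A).
      case/orP: dx => [|dx]; first by rewrite (negPf xA).
      by exists x => //; apply/exists_inP; exists y; rewrite // e_sym.
    move: dx dy; rewrite (negPf xA) (negPf yA) /= => dx dy.
    have [||a aA] := covA x y _ _ xy; rewrite ?inE //.
    by case/orP=> ea; [exists x|exists y] => //; apply/exists_inP; exists a.
  move=> /msuppM_ex [m1 [m2 [/Ph [x /exists_inP [a aA ax] dx] /mem_msuppXP <- ->]]].
  apply/graph_monP; left; exists a, x; rewrite !divides_varD dx dA aA orbT.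
  by rewrite !inE.
have homA : 'X_[mA] \is [in K[n], #|A|.-homog].
  apply/dhomogP => mo /mem_msuppXP <-; rewrite /= mdeg_sum.
  by under eq_bigr do rewrite mdeg1; rewrite sum1_card.
exists 'X_[mA], P; split=> //; split; last by exists 'X_[mA] => h; rewrite colP.
have idP : is_ideal P.
  pose JP (mo : mon) := [exists x, C x && divides_var x mo].
  have PJ h : P h <-> mono_ideal JP h.
    split=> Ph mo /Ph.
      by case=> x Cx dx; apply/existsP; exists x; rewrite Cx.
    by case/existsP=> x /andP [Cx dx]; exists x.
  have upJ : up_closed JP.
    move=> m1 m2 /existsP [x /andP [Cx dx]]; apply/existsP; exists x.
    by rewrite Cx divides_varD dx.
  have [I0 ID IM] := mono_ideal_is_ideal K upJ.
  by split; [apply/PJ|move=> a b /PJ ? /PJ ?; apply/PJ/ID|move=> a b /PJ ?; apply/PJ/IM].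
split=> //.
  move=> /(_ 0%MM); rewrite msupp1 inE eqxx => /(_ isT) [x _].
  by rewrite /divides_var mnm0E.
move=> a b Pab; have [P0 PD PM] := idP.
pose free (mo : mon) := [forall x, C x ==> ~~ divides_var x mo].
(* Modulo P, a and b are polynomials in the free variables, a domain. *)
have splitf f : exists f0 f1, [/\ f = f0 + f1, P f1 & forall mo, mo \in msupp f0 -> free mo].
  exists (mfilter free f), (mfilter (predC free) f); split; first exact: mfilter_split.
    move=> mo; rewrite mcoeff_msupp mcoeff_filter /=.
    case: ifP; rewrite ?eqxx // => /forallPn [x]; rewrite negb_imply negbK.
    by case/andP=> Cx dx _; exists x.
  by move=> mo; rewrite mcoeff_msupp mcoeff_filter; case: ifP; rewrite ?eqxx.
have [a0 [a1 [ea Pa1 fa0]]] := splitf a.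
have [b0 [b1 [eb Pb1 fb0]]] := splitf b.
have Pab0 : P (a0 * b0).
  have -> : a0 * b0 = a * b + (- b * a1 + (- a0) * b1).
    by rewrite ea eb; ring.
  by apply: (PD) => //; apply: (PD); apply: (PM).
have /eqP : a0 * b0 = 0.
  apply: msuppnil0; case E: (msupp _) => [|mo s] //.
  have mo0 : mo \in msupp (a0 * b0) by rewrite E mem_head.
  have [x Cx dx] := Pab0 mo mo0.
  have [m1 [m2 [/fa0 /forallP/(_ x) f1 /fb0 /forallP/(_ x) f2 emo]]] := msuppM_ex mo0.
  by move: dx f1 f2; rewrite emo divides_varD Cx /= => /orP [] ->.
rewrite mulf_eq0 => /orP [] /eqP e0; [left|right].
  by rewrite ea e0 add0r.
by rewrite eb e0 add0r.
Qed.

End EdgeIdeals.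

(** * Ordering the variables along a maximum induced matching *)

Section MatchingLists.
Variables (V : finType) (e : rel V).
Hypotheses (e_sym : ssrbool.symmetric e) (e_irr : irreflexive e).
Local Notation n := #|V|.
Local Notation mon := 'X_{1..n}.
Local Notation J := (graph_mon e setT set0).
Implicit Types (l : seq (V * V)).

Definition pair_set (p : V * V) : {set V} := [set p.1; p.2].
Definition far_pairs (p q : V * V) : bool :=
  [forall x in pair_set p, forall y in pair_set q, (x != y) && ~~ e x y].

Lemma far_pairsP p q : reflect
  {in pair_set p & pair_set q, forall x y, x != y /\ ~~ e x y} (far_pairs p q).
Proof.
apply: (iffP forall_inP) => [h x y xp yq|h x xp].
  by have /forall_inP/(_ y yq)/andP := h x xp.
by apply/forall_inP => y yq; apply/andP/h.
Qed.

Lemma induced_matching_list : exists l,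
  [/\ size l = induced_matching_number e, all (fun p => e p.1 p.2) l & pairwise far_pairs l].
Proof.
have [|M iM eM] := @eq_bigmax_cond _ (induced_matching e) (fun M => #|M|).
  by apply/card_gt0P; exists set0; apply: induced_matching0.
have /and3P [/forall_inP edM /trivIsetP tM /forallP cM] : induced_matching e M := iM.
have [l el al] : exists2 l, map pair_set l = enum M & all (fun p => e p.1 p.2) l.
  have: {subset enum M <= M} by move=> A; rewrite mem_enum.
  elim: (enum M) => [|A s IH] sM; first by exists [::].
  have [|l el al] := IH; first by move=> B Bs; apply: sM; rewrite inE Bs orbT.
  have /edM/is_edgeP [x [y [xy eA]]] : A \in M by apply: sM; rewrite mem_head.
  by exists ((x, y) :: l); rewrite /= ?xy // el eA.
exists l; split=> //.
  by rewrite /induced_matching_number eM cardE -el size_map.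
have inM p : p \in l -> pair_set p \in M.
  by move=> pl; rewrite -mem_enum -el map_f.
have ul : uniq (map pair_set l) by rewrite el enum_uniq.
elim: l ul inM {el al} => [|p l IH] //= /andP [pl ul] inM.
rewrite IH ?andbT //; last by move=> q ql; apply: inM; rewrite inE ql orbT.
apply/allP=> q ql; apply/far_pairsP => x y xp yq.
have pM : pair_set p \in M by apply: inM; rewrite mem_head.
have qM : pair_set q \in M by apply: inM; rewrite inE ql orbT.
have npq : pair_set p != pair_set q.
  by apply: contraNneq pl => ->; apply: map_f.
have xy : x != y.
  by apply: contraTneq yq => <-; rewrite (disjointFr (tM _ _ pM qM npq)).
split=> //; apply: contraL npq => exy.
have eM' : [set x; y] \in M.
  have /implyP := cM [set x; y]; apply; apply/andP; split.
    by apply/is_edgeP; exists x, y.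
  apply/subsetP=> z /set2P [->|->]; apply/bigcupP.
    by exists (pair_set p).
  by exists (pair_set q).
have meet (B C : {set V}) z : B \in M -> C \in M -> z \in B -> z \in C -> B = C.
  move=> BM CM zB zC; apply/eqP; apply: contraT => nBC.
  by have := disjointFr (tM _ _ BM CM nBC) zB; rewrite zC.
rewrite negbK -(meet _ _ x eM' pM) ?set21 // (meet _ _ y eM' qM) ?set22 //.
Qed.

Definition rank_pair (p : V * V) : 'I_n * 'I_n := (enum_rank p.1, enum_rank p.2).

Lemma matching_vars_cat rest l :
  matching_vars rest (map rank_pair l) = matching_vars [::] (map rank_pair l) ++ rest.
Proof. by elim: l => //= p l ->. Qed.

Lemma matching_vars_mem l x :
  (enum_rank x \in matching_vars [::] (map rank_pair l)) = has (fun p => x \in pair_set p) l.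
Proof.
elim: l => //= p l IH.
by rewrite !(inE, in_set) !(inj_eq enum_rank_inj) IH orbA.
Qed.

Lemma matching_vars_uniq l : all (fun p => e p.1 p.2) l -> pairwise far_pairs l ->
  uniq (matching_vars [::] (map rank_pair l)).
Proof.
elim: l => //= p l IH /andP [ep al] /andP [/allP far /(IH al) ->].
rewrite inE (inj_eq enum_rank_inj) negb_or (edge_neq e_irr ep) !matching_vars_mem /= andbT.
apply/andP; split; apply/hasPn=> q /far /far_pairsP h; apply/negP=> pq.
  by have [] := h _ _ (set21 _ _) pq; rewrite eqxx.
by have [] := h _ _ (set22 _ _) pq; rewrite eqxx.
Qed.

(** The vertices of a transversal are pairwise nonadjacent. The induction runs over
    the edges left, mo being the product of the ends already chosen. *)
Lemma matching_transversals rest l mo :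
    all (fun p => e p.1 p.2) l -> pairwise far_pairs l ->
    (forall x y, divides_var x mo -> divides_var y mo -> ~~ e x y) ->
    (forall x p, divides_var x mo -> p \in l ->
      {in pair_set p, forall y, ~~ e x y}) ->
    (forall x, divides_var x mo -> enum_rank x \notin rest) ->
    (forall x p, p \in l -> x \in pair_set p -> enum_rank x \notin rest) ->
  transversals_out J rest (map rank_pair l) mo.
Proof.
elim: l mo => [|p l IH] mo /=.
  move=> _ _ ind _ rest0 _; split.
    apply/negP=> /graph_monP [[x [y [_ _ xy dx dy]]]|[u]]; last by rewrite inE.
    by have := ind x y dx dy; rewrite xy.
  move=> t tr; apply/eqP; rewrite -leqn0 leqNgt; apply/negP=> t0.
  by have := rest0 (enum_val t); rewrite /divides_var enum_valK tr => /(_ t0).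
case/andP=> ep al /andP [/allP far pl] ind indl rest0 restl.
suff step x : x \in pair_set p -> transversals_out J rest (map rank_pair l) (mo + U_(enum_rank x))%MM.
  by split; apply: step; rewrite ?set21 ?set22.
move=> xp; apply: IH => //.
- move=> a b; rewrite !divides_varD !divides_varU.
  case/orP=> [da|/eqP ->]; case/orP=> [db|/eqP ->]; rewrite ?e_irr //.
  + exact: ind.
  + by apply: (indl a p) => //; rewrite mem_head.
  + by rewrite e_sym; apply: (indl b p) => //; rewrite mem_head.
- move=> a q; rewrite divides_varD divides_varU => da ql y yq.
  case/orP: da => [da|/eqP ->].
    by apply: (indl a q) => //; rewrite inE ql orbT.
  by have /far_pairsP/(_ x y xp yq) [] := far q ql.
- move=> a; rewrite divides_varD divides_varU => /orP [|/eqP ->]; first exact: rest0.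
  by apply: (restl x p) => //; rewrite mem_head.
- by move=> a q ql; apply: restl; rewrite inE ql orbT.
Qed.

End MatchingLists.

Lemma ex_least_nat (P : nat -> Prop) d : P d -> exists2 v, P v & forall d', P d' -> (v <= d')%N.
Proof.
have [m dm] := ubnP d; elim: m d dm => // m IH d dm Pd.
have [[d' [Pd' lt]]|no] := classic (exists d', P d' /\ (d' < d)%N).
  by apply: (IH d') => //; apply: leq_trans lt _; rewrite -ltnS.
exists d => // d' Pd'; rewrite leqNgt; apply/negP=> lt; apply: no.
by exists d'.
Qed.

Local Close Scope ring_scope.

Theorem theorem4p11 (K : fieldType) (V : finType) (e : rel V)
    (e_sym : ssrbool.symmetric e) (e_irr : irreflexive e)
    (e_free : C4_C5_free e) (e_vd : vertex_decomposable e) :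
  exists v r : nat,
    [/\ is_vnumber (edge_ideal K e) v,
        is_regularity (edge_ideal K e) r,
        v <= induced_matching_number e
      & induced_matching_number e = r].
Proof.
have sd : shedding_depth e setT (induced_matching_number e).
  rewrite -matching_numberT.
  exact: (vd_shedding_depth e_sym e_irr e_free e_vd (ind_complexT e)).
set r := induced_matching_number e in sd *.
have [d dr vd] := v_degree_le_depth K e_sym e_irr sd.
have [v vv vmin] := ex_least_nat vd.
exists v, r; split=> //; last by apply: leq_trans dr; apply: vmin.
have [l [szl al pl]] := induced_matching_list e.
pose vs := matching_vars [::] (map (@rank_pair V) l).
pose rest := [seq t <- enum 'I_#|V| | t \notin vs].
pose ts := matching_vars rest (map (@rank_pair V) l).
have ets : ts = vs ++ rest by exact: matching_vars_cat.
have uts : uniq ts.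
  rewrite ets cat_uniq (matching_vars_uniq e_irr al pl) filter_uniq ?enum_uniq // andbT.
  by apply/hasPn => t; rewrite mem_filter => /andP [].
have fts t : t \in ts.
  by rewrite ets mem_cat mem_filter mem_enum andbT orbN.
have van := edge_ideal_bounded e_sym e_irr uts fts sd (K := K).
have idI := edge_ideal_is_ideal K e.
have bnd : exists B, forall p j, (B + p < j)%N -> quotient_vanish ts (edge_ideal K e) p j.
  by exists r => p j; rewrite addnC; apply: van.
have gr := @edge_ideal_gr K V e e_irr; have nu := @edge_ideal_nonunit K V e e_irr.
split.
  have minF := min_resolutionP uts fts idI gr nu bnd.
  have nV : ~ quotient_vanish ts (edge_ideal K e) r (r + r).
    have -> : r = size (map (@rank_pair V) l) by rewrite size_map szl.
    move=> /(edge_ideal_vanish _ e_irr); apply: matching_nonvanish.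
    - exact: graph_mon_up.
    - move=> _ /mapP [p pinl ->]; apply/graph_monP; left; exists p.1, p.2.
      by rewrite !divides_varD !divides_varU !eqxx orbT !inE (allP al).
    - apply: (matching_transversals e_sym e_irr al pl) => [x y|x p|x|x p pl' xp].
      + by rewrite /divides_var mnm0E.
      + by rewrite /divides_var mnm0E.
      + by rewrite /divides_var mnm0E.
      rewrite mem_filter negb_and negbK matching_vars_mem; apply/orP; left.
      by apply/hasP; exists p.
  have [k ek] := generator_nonvanish uts fts idI gr minF nV.
  eexists r, (r + r)%N, _; split; last by [].
    by exists (min_resolution uts fts idI gr nu bnd).
  by apply/eqP; rewrite -lt0n; apply/card_gt0P; exists k; rewrite inE ek.
move=> i j b [F' [minF' ->]] /eqP; rewrite -lt0n => /card_gt0P [k]; rewrite inE => /eqP ek.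
rewrite leqNgt; apply/negP=> lt.
by case: (vanish_no_generator uts fts idI gr minF' (van _ _ lt) ek).
Qed.
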